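(* Let $\Bbbk$ be a field, $n\ge1$, and let $A$ be the incidence algebra over $\Bbbk$ of the commutative ladder of length $n$, with set of intervals $\mathbb{I}$ (also identified with the set of interval modules $\{V_I\mid I\in\mathbb{I}\}$). Then the interval approximation with respect to $\xi$, which associates to $M\in\operatorname{mod}A$ the function $\delta_M^{\xi}:\mathbb{I}\to\mathbb{Z}$ and is regarded as an invariant $K_0^{\mathrm{split}}(A)\to\mathbb{Z}^{\mathbb{I}}$, is the homological invariant relative to $\mathbb{I}$ (and thus it is equivalent to the dim-hom invariant relative to $\mathbb{I}$).
   Context: Commutative ladder. The poset $\mathcal{P}=\{x_1,\dots,x_n,y_1,\dots,y_n\}$ with $x_i\le x_j$, $y_i\le y_j$, $x_i\le y_j$ each holding exactly when $i\le j$, and never $y_i\le x_j$. $A$ is its incidence algebra, also regarded as the $\Bbbk$-linear category with object set $\mathcal{P}$ in which $A(p,q)$ is one-dimensional with distinguished basis element $u_{q,p}$ if $p\le q$ and is $0$ otherwise, with $u_{s,q}u_{q,p}=u_{s,p}$ and $u_{p,p}$ the identity. $\operatorname{mod}A$ is the category of functors $\mathcal{P}\to\mathrm{vect}_\Bbbk$ into finite-dimensional spaces (equivalently $\Bbbk$-linear functors from the category $A$). Intervals. An interval is a nonempty subset of $\mathcal{P}$ that is convex and connected in the Hasse diagram; $\mathbb{I}$ is the set of intervals, partially ordered by inclusion. $V_I$ is the module with $V_I(x)=\Bbbk$ for $x\in I$, $0$ otherwise, and identity maps between comparable points of $I$. Each interval is exactly one of: (i) $\{x_i,\dots,x_j\}\cup\{y_k,\dots,y_l\}$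 with $1\le k\le i\le l\le j\le n$; (ii) $\{x_i,\dots,x_j\}$ with $1\le i\le j\le n$; (iii) $\{y_k,\dots,y_l\}$ with $1\le k\le l\le n$. Compressed multiplicity. Let $Q'$ be the quiver with vertices $1,\dots,5$ and arrows $\alpha_1:2\to1$, $\alpha_2:2\to3$, $\alpha_3:4\to3$, $\alpha_4:4\to5$, and $B=\Bbbk Q'$ its path category. For $I\in\mathbb{I}$ define $\xi_I$ on $(1,2,3,4,5)$ by $(y_l,y_k,y_i,x_i,x_j)$ in case (i), $(x_j,x_i,x_i,x_i,x_j)$ in case (ii), $(y_l,y_k,y_k,y_k,y_l)$ in case (iii); each arrow $\alpha:a\to b$ is sent to $u_{\xi_I(b),\xi_I(a)}$. This extends to a $\Bbbk$-linear functor $F_I:B\to A$, and $R_I(M):=M\circ F_I$. Then $c_M^{\xi}(I)$ is the multiplicity of the indecomposable $B$-module $R_I(V_I)$ as a direct summand of $R_I(M)$. Interval approximation. $\delta_M^{\xi}(J):=\sum_{S\subseteq\operatorname{Cov}(J)}(-1)^{\#S}c_M^{\xi}(\bigvee S)$ for $J\in\mathbb{I}$, where $\operatorname{Cov}(J)$ is the set of elements of $\mathbb{I}$ covering $J$ (minimal among the intervals strictly containing $J$), $\bigvee S$ is the join (least upper bound) of $S$ in $\mathbb{I}$, and $\bigvee\emptyset$ is read as $J$. This is the Möbius inversion of $c_M^{\xi}$: $c_M^{\xi}(I)=\sum_{J\supseteq I}\delta_M^{\xi}(J)$. Homological invariants. For a finite set $\mathcal{X}$ of indecomposable modules and $\mathcal{I}=\operatorname{add}\mathcal{X}$,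 a right $\mathcal{I}$-approximation of $N$ is a morphism $f:X\to N$ with $X\in\mathcal{I}$ through which every morphism $Y\to N$ with $Y\in\mathcal{I}$ factors. $K_0(A,\mathcal{X})$ is the free abelian group on isomorphism classes $[M]$, $M\in\operatorname{mod}A$, modulo the subgroup generated by $[M]-[L]-[N]$ for all short exact sequences $0\to L\to M\xrightarrow{f_1}N\to0$ with $f_1$ a right $\mathcal{I}$-approximation. $K_0^{\mathrm{split}}(A)$ is defined likewise using all split short exact sequences. An invariant is a surjective group homomorphism $p:K_0^{\mathrm{split}}(A)\to\mathbb{Z}^m$ for some $m$; two invariants are equivalent if they have the same kernel. An invariant $p$ is a homological invariant relative to $\mathcal{X}$ if: (a) all indecomposable projectives are in $\mathcal{I}$; (b) every $M\in\operatorname{mod}A$ has a finite $\mathcal{I}$-resolution, i.e. a finite sequence $0\to X_m\to\cdots\to X_0\xrightarrow{f_0}M\to0$ with $f_0$ a right $\mathcal{I}$-approximation of $M$ and each $f_i:X_i\to X_{i-1}$ ($i\ge1$) inducing a right $\mathcal{I}$-approximation of $\operatorname{Ker}f_{i-1}$ (with $X_{m+1}=0$); (c) $p$ is equivalent to the canonical quotient map $K_0^{\mathrm{split}}(A)\to K_0(A,\mathcal{X})\cong\mathbb{Z}^{|\mathcal{X}|}$ (under (a), (b) the group $K_0(A,\mathcal{X})$ is free with basis $\{[X]\mid X\in\mathcal{X}\}$). The dim-hom invariant relative to $\mathbb{I}$ is $K_0^{\mathrm{split}}(A)\to\mathbb{Z}^{\mathbb{I}}$, $[M]\mapsto(\dim_\Bbbk\operatorname{Hom}_A(V_I,M))_{I\in\mathbb{I}}$.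 *)

(* Defs.v *)
From HB Require Import structures.
From mathcomp Require Import all_boot all_order all_algebra ring_quotient.
From mathcomp Require Import boolp classical_sets.
From mathcomp.multinomials Require Import freeg.

Set Implicit Arguments.
Unset Strict Implicit.
Unset Printing Implicit Defensive.

Import Order.TTheory GRing.Theory Num.Theory.
Local Open Scope ring_scope.

(* Composition is written in diagrammatic order. *)
Record category := Category {
  obj :> Type;
  arr : obj -> obj -> Type;
  idc : forall a, arr a a;
  compc : forall a b c, arr a b -> arr b c -> arr a c;
  compc1l : forall a b (f : arr a b), compc (idc a) f = f;
  compc1r : forall a b (f : arr a b), compc f (idc b) = f;
  compcA : forall a b c d (f : arr a b) (g : arr b c) (h : arr c d),
    compc f (compc g h) = compc (compc f g) h }.

Arguments arr {c0} a b : rename.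
Arguments idc {c0} a : rename.
Arguments compc {c0} {a b c} f g : rename.

Record functor (C D : category) := Functor {
  fobj :> C -> D;
  farr : forall a b : C, arr a b -> arr (fobj a) (fobj b);
  farr1 : forall a : C, farr (idc a) = idc (fobj a);
  farrM : forall (a b c : C) (f : arr a b) (g : arr b c),
    farr (compc f g) = compc (farr f) (farr g) }.

Arguments farr {C D} F {a b} f : rename.

Section PosetCategory.
Context {d : Order.disp_t} (P : porderType d).

(* The unique inhabitant of [arr p q] is the basis element u_{q,p}. *)
Definition poset_cat : category :=
  @Category P (fun p q => is_true (p <= q)%O) (fun p => lexx p)
    (fun p q r pq qr => le_trans pq qr)
    (fun p q f => bool_irrelevance _ f)
    (fun p q f => bool_irrelevance _ f)
    (fun p q r s f g h => bool_irrelevance _ _).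

End PosetCategory.

Record quiver := Quiver {
  vertex : Type;
  arrow : vertex -> vertex -> Type }.

Section PathCategory.
Variable Q : quiver.

Inductive qpath : vertex Q -> vertex Q -> Type :=
| QNil a : qpath a a
| QCons a b c : arrow a b -> qpath b c -> qpath a c.

Fixpoint qcat a b c (p : qpath a b) : qpath b c -> qpath a c :=
  match p in qpath a b return qpath b c -> qpath a c with
  | QNil _ => fun q => q
  | QCons _ _ _ e p' => fun q => QCons e (qcat p' q)
  end.

Lemma qcat1r a b (p : qpath a b) : qcat p (QNil b) = p.
Proof. by elim: p => //= a0 b0 c0 e p ->. Qed.

Lemma qcatA a b c e (p : qpath a b) (q : qpath b c) (r : qpath c e) :
  qcat p (qcat q r) = qcat (qcat p q) r.
Proof. by elim: p q => //= a0 b0 c0 x p IH q; rewrite IH. Qed.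

Definition path_cat : category :=
  @Category (vertex Q) qpath QNil qcat
    (fun a b f => erefl f) qcat1r qcatA.

Variables (C : category) (o : vertex Q -> C).
Variable u : forall a b, arrow a b -> arr (o a) (o b).

Fixpoint path_farr a b (p : qpath a b) : arr (o a) (o b) :=
  match p in qpath a b return arr (o a) (o b) with
  | QNil a => idc (o a)
  | QCons _ _ _ e p' => compc (u e) (path_farr p')
  end.

Lemma path_farrM a b c (p : qpath a b) (q : qpath b c) :
  path_farr (qcat p q) = compc (path_farr p) (path_farr q).
Proof.
elim: p q => /= [a0 q|a0 b0 c0 e p IH q]; first by rewrite compc1l.
by rewrite IH compcA.
Qed.

Definition path_functor : functor path_cat C :=
  @Functor path_cat C o path_farr (fun a => erefl) path_farrM.

End PathCategory.

(* A module is a functor into the skeletal category of the spaces 'rV[k]_m.     *)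
(* Linear maps act on row vectors from the right, so diagrammatic           *)
(* composition is the product *m.                                           *)

Section Modules.
Variables (k : fieldType) (C : category).

Record rep := Rep {
  rdim :> C -> nat;
  rmap : forall a b : C, arr a b -> 'M[k]_(rdim a, rdim b);
  rmap1 : forall a : C, rmap (idc a) = 1%:M;
  rmapM : forall (a b c : C) (f : arr a b) (g : arr b c),
    rmap (compc f g) = rmap f *m rmap g }.

Record hom (M N : rep) := Hom {
  hmap :> forall a : C, 'M[k]_(M a, N a);
  hmap_nat : forall (a b : C) (f : arr a b),
    rmap M f *m hmap b = hmap a *m rmap N f }.

Definition iso (M N : rep) : Prop :=
  exists (f : hom M N) (g : hom N M),
    forall a, f a *m g a = 1%:M /\ g a *m f a = 1%:M.

Definition is_zero (M : rep) : Prop := forall a, M a = 0%N.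

Program Definition zero_rep : rep := @Rep (fun=> 0%N) (fun _ _ _ => 0) _ _.
Next Obligation. by rewrite [RHS]flatmx0. Qed.
Next Obligation. by rewrite mulmx0. Qed.

Program Definition dsum (M N : rep) : rep :=
  @Rep (fun a => M a + N a)%N
       (fun a b f => block_mx (rmap M f) 0 0 (rmap N f)) _ _.
Next Obligation. by rewrite !rmap1 -scalar_mx_block. Qed.
Next Obligation.
by rewrite !rmapM mulmx_block !mulmx0 !mul0mx !addr0 !add0r.
Qed.

Definition dsums (s : seq rep) : rep := foldr dsum zero_rep s.

Definition indecomposable (M : rep) : Prop :=
  ~ is_zero M /\
  forall N1 N2, iso M (dsum N1 N2) -> is_zero N1 \/ is_zero N2.

(* The multiplicity of the indecomposable N in M is the number of summands  *)
(* isomorphic to N in a decomposition of M into indecomposables; by the     *)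
(* Krull-Schmidt theorem there is exactly one such number.                  *)
Definition is_multiplicity (N M : rep) (m : nat) : Prop :=
  exists s : seq rep,
    [/\ forall i, (i < size s)%N -> indecomposable (nth zero_rep s i),
        iso M (dsums s)
      & m = count (fun X => `[< iso X N >]) s].

Definition multiplicity (N M : rep) : nat :=
  xget 0%N [set m | is_multiplicity N M m]%classic.

Definition hom_basis (M N : rep) m (b : 'I_m -> hom M N) : Prop :=
  forall f : hom M N, exists! c : 'rV[k]_m,
    forall a, f a = \sum_i c ord0 i *: b i a.

Definition hom_dim (M N : rep) : nat :=
  xget 0%N [set m | exists b : 'I_m -> hom M N, hom_basis b]%classic.

(* Kernels and exactness are computed pointwise. *)
Definition mono (M N : rep) (f : hom M N) : Prop := forall a, row_free (f a).
Definition epi (M N : rep) (f : hom M N) : Prop := forall a, row_full (f a).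

Definition is_kernel (L M N : rep) (g : hom L M) (f : hom M N) : Prop :=
  mono g /\ forall a, (g a == kermx (f a))%MS.

Definition short_exact (L M N : rep) (g : hom L M) (f : hom M N) : Prop :=
  is_kernel g f /\ epi f.

Definition projective (P : rep) : Prop :=
  forall (M N : rep) (e : hom M N) (f : hom P N), epi e ->
    exists h : hom P M, forall a, h a *m e a = f a.

Section Relative.
Variables (T : finType) (X : T -> rep).

Definition indecomposable_family : Prop :=
  (forall t, indecomposable (X t)) /\
  (forall t u, iso (X t) (X u) -> t = u).

Definition in_add (M : rep) : Prop :=
  exists (N : rep) (s : seq T), iso (dsum M N) (dsums [seq X t | t <- s]).

Definition right_approx (M N : rep) (f : hom M N) : Prop :=
  in_add M /\
  forall Y, in_add Y -> forall g : hom Y N,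
    exists h : hom Y M, forall a, h a *m f a = g a.

(* g induces a right approximation of the kernel of f. *)
Definition induces_approx (L M N : rep) (g : hom L M) (f : hom M N) : Prop :=
  exists (K : rep) (i : hom K M) (g' : hom L K),
    [/\ is_kernel i f, forall a, g a = g' a *m i a & right_approx g'].

(* The finite sequence 0 -> R_m -> ... -> R_0 -> M -> 0 is extended by zero *)
(* to an N-indexed one. [f i] is f_{i+1}. The condition on f_{m+1} is the   *)
(* one at R_{m+1} = 0, and those on f_j with j > m + 1 hold trivially.      *)
Definition has_finite_resolution (M : rep) : Prop :=
  exists (m : nat) (R : nat -> rep)
         (f0 : hom (R 0%N) M) (f : forall i, hom (R i.+1) (R i)),
    [/\ forall i, in_add (R i), forall i, (m < i)%N -> is_zero (R i),
        right_approx f0, induces_approx (f 0%N) f0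
      & forall i, induces_approx (f i.+1) (f i)].

End Relative.

Lemma iso_refl M : iso M M.
Proof.
have nat1 (a b : C) (f : arr a b) : rmap M f *m 1%:M = 1%:M *m rmap M f.
  by rewrite mulmx1 mul1mx.
by exists (Hom nat1), (Hom nat1) => a /=; rewrite mulmx1.
Qed.

Lemma iso_sym M N : iso M N -> iso N M.
Proof. by move=> [f [g fg]]; exists g, f => a; have [] := fg a. Qed.

Lemma iso_trans M N L : iso M N -> iso N L -> iso M L.
Proof.
move=> [f [g fg]] [f' [g' fg']].
have nat1 (a b : C) (e : arr a b) :
    rmap M e *m (f b *m f' b) = (f a *m f' a) *m rmap L e.
  by rewrite mulmxA hmap_nat -mulmxA hmap_nat mulmxA.
have nat2 (a b : C) (e : arr a b) :
    rmap L e *m (g' b *m g b) = (g' a *m g a) *m rmap M e.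
  by rewrite mulmxA hmap_nat -mulmxA hmap_nat mulmxA.
exists (Hom nat1), (Hom nat2) => a /=.
have [fga gfa] := fg a; have [fga' gfa'] := fg' a.
split; rewrite mulmxA.
  by rewrite -(mulmxA (f a)) fga' mulmx1.
by rewrite -(mulmxA (g' a)) gfa mulmx1.
Qed.

Definition isob : rel {classic rep} := fun M N => `[< iso M N >].

Lemma isob_refl : reflexive isob.
Proof. by move=> M; apply/asboolP/iso_refl. Qed.

Lemma isob_sym : symmetric isob.
Proof. by move=> M N; apply/asboolP/asboolP => /iso_sym. Qed.

Lemma isob_trans : transitive isob.
Proof.
move=> N M L /asboolP MN /asboolP NL; apply/asboolP.
exact: iso_trans MN NL.
Qed.

Canonical isob_equiv := EquivRel isob isob_refl isob_sym isob_trans.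

Definition iso_class : choiceType := {eq_quot isob}%qT.

Definition free_class (M : rep) : {freeg iso_class} :=
  << \pi_iso_class (M : {classic rep}) >>%qT.

Definition ses_class := forall L M N : rep, hom L M -> hom M N -> Prop.

Section K0.
Variable E : ses_class.

Definition K0_relator (x : {freeg iso_class}) : Prop :=
  exists (L M N : rep) (g : hom L M) (f : hom M N),
    [/\ short_exact g f, E g f
      & x = free_class M - free_class L - free_class N].

Inductive K0_relation : {freeg iso_class} -> Prop :=
| K0_relation0 : K0_relation 0
| K0_relation_gen x : K0_relator x -> K0_relation x
| K0_relationB x y : K0_relation x -> K0_relation y -> K0_relation (x - y).

Definition K0_relations : {pred {freeg iso_class}} :=
  fun x => `[< K0_relation x >].

Lemma K0_relations_closed : zmod_closed K0_relations.
Proof.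
split=> [|x y /asboolP xR /asboolP yR]; apply/asboolP.
  exact: K0_relation0.
exact: K0_relationB.
Qed.

HB.instance Definition _ :=
  GRing.isZmodClosed.Build {freeg iso_class} K0_relations K0_relations_closed.

Definition K0 : zmodType := Quotient.quot K0_relations.

Definition K0_class (M : rep) : K0 := (\pi_K0 (free_class M))%qT.

End K0.

Definition split_ses : ses_class := fun L M N _ f =>
  exists s : hom N M, forall a, s a *m f a = 1%:M.

Definition K0_split : zmodType := K0 split_ses.

Definition approx_ses (T : finType) (X : T -> rep) : ses_class :=
  fun L M N _ f => right_approx X f.

Definition K0_rel (T : finType) (X : T -> rep) : zmodType := K0 (approx_ses X).

(* Z^m is written {ffun U -> int} with U a finite index type. *)
Definition is_invariant (U : finType) (p : {additive K0_split -> {ffun U -> int}})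
  : Prop := forall y, exists x, p x = y.

Definition equivalent (G H1 H2 : zmodType) (p : {additive G -> H1})
  (q : {additive G -> H2}) : Prop := forall x, p x = 0 <-> q x = 0.

(* q is the canonical quotient map. The relators of K0_rel involve only     *)
(* sequences whose middle term is in add X, hence not every split sequence; *)
(* that q is well defined uses the existence of finite resolutions.         *)
Definition homological_invariant (T : finType) (X : T -> rep) (U : finType)
    (p : {additive K0_split -> {ffun U -> int}}) : Prop :=
  [/\ indecomposable_family X, is_invariant p,
      forall P, projective P -> indecomposable P -> in_add X P,
      forall M, has_finite_resolution X M
    & exists (q : {additive K0_split -> K0_rel X})
             (phi : {additive K0_rel X -> {ffun T -> int}}),
        [/\ forall M, q (K0_class split_ses M) = K0_class (approx_ses X) M,
            bijective phi,
            forall t, phi (K0_class (approx_ses X) (X t))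
                      = [ffun u => (u == t)%:R]
          & equivalent p (phi \o q)]].

End Modules.

Arguments zero_rep {k C}.

Definition precomp (k : fieldType) (C D : category) (F : functor C D)
  (M : rep k D) : rep k C :=
  @Rep k C (fun a => M (F a)) (fun a b f => rmap M (farr F f))
    (fun a => etrans (congr1 (fun u => rmap M u) (farr1 F a)) (rmap1 M (F a)))
    (fun a b c f g => etrans (congr1 (fun u => rmap M u) (farrM F f g))
                             (rmapM M (farr F f) (farr F g))).

Section Intervals.
Context {d : Order.disp_t} (P : finPOrderType d).

Definition hasse_covers (x y : P) : bool :=
  (x < y)%O && [forall z, ~~ ((x < z)%O && (z < y)%O)].

Definition hasse_edge_in (I : {set P}) : rel P := fun x y =>
  [&& x \in I, y \in I & hasse_covers x y || hasse_covers y x].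

Definition convex_set (I : {set P}) : bool :=
  [forall x in I, forall z in I, forall y, (x <= y <= z)%O ==> (y \in I)].

Definition connected_set (I : {set P}) : bool :=
  [forall x in I, forall y in I, connect (hasse_edge_in I) x y].

Definition is_interval (I : {set P}) : bool :=
  [&& I != finset.set0, convex_set I & connected_set I].

Record pinterval := PInterval { ival :> {set P}; ivalP : is_interval ival }.

HB.instance Definition _ := [isSub for ival].
HB.instance Definition _ := [Finite of pinterval by <:].

Lemma interval_convex (I : pinterval) x y z :
  x \in (I : {set P}) -> z \in (I : {set P}) -> (x <= y)%O -> (y <= z)%O ->
  y \in (I : {set P}).
Proof.
case: I => I /= /and3P[_ /forall_inP cI _] xI zI xy yz.
by move: (forall_inP (cI x xI) z zI) => /forallP/(_ y); rewrite xy yz.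
Qed.

Lemma interval_neq0 (I : pinterval) : exists x, x \in (I : {set P}).
Proof. by case: I => I /= /and3P[/finset.set0Pn]. Qed.

Definition interval_dim (I : pinterval) (x : P) : nat := x \in (I : {set P}).

Lemma interval_map1 (k : fieldType) (I : pinterval) (x : P) :
  const_mx 1 = 1%:M :> 'M[k]_(interval_dim I x, interval_dim I x).
Proof.
rewrite /interval_dim; case: (x \in _) => /=.
  by apply/matrixP => i j; rewrite !mxE !ord1.
by rewrite [RHS]flatmx0 [LHS]flatmx0.
Qed.

Lemma interval_mapM (k : fieldType) (I : pinterval) (x y z : P) :
  (x <= y)%O -> (y <= z)%O ->
  const_mx 1 = (const_mx 1 : 'M[k]_(interval_dim I x, interval_dim I y))
               *m (const_mx 1 : 'M[k]_(interval_dim I y, interval_dim I z)).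
Proof.
rewrite /interval_dim => xy yz; apply/matrixP => i j; rewrite !mxE.
have xI : x \in (I : {set P}) by case: (x \in _) i => [//|[]].
have zI : z \in (I : {set P}) by case: (z \in _) j => [//|[]].
under eq_bigr do rewrite !mxE mulr1.
by rewrite (interval_convex xI zI xy yz) big_ord1.
Qed.

(* [const_mx 1] is the identity of k when both points are in I, and is an   *)
(* empty matrix otherwise.                                                  *)
Definition interval_rep (k : fieldType) (I : pinterval) : rep k (poset_cat P) :=
  @Rep k (poset_cat P) (interval_dim I) (fun x y _ => const_mx 1)
    (interval_map1 k I) (@interval_mapM k I).

Definition Cov (J : pinterval) : {set pinterval} :=
  [set K : pinterval | (J \proper K) &&
     [forall L : pinterval, ~~ ((J \proper L) && (L \proper K))]].

Definition is_join (S : {set pinterval}) (K : pinterval) : bool :=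
  [forall L in S, (L : pinterval) \subset K] &&
  [forall K' : pinterval,
     [forall L in S, (L : pinterval) \subset K'] ==> (K \subset K')].

(* For a nonempty S contained in Cov J the join exists. *)
Definition join_above (J : pinterval) (S : {set pinterval}) : pinterval :=
  if S == finset.set0 then J else odflt J [pick K | is_join S K].

End Intervals.


(* Zero-based: [lx i] is x_{i+1} and [ly i] is y_{i+1}. *)
Definition ladder (n : nat) := (bool *p 'I_n)%type.
Definition lx n (i : 'I_n) : ladder n := (false, i).
Definition ly n (i : 'I_n) : ladder n := (true, i).

Lemma le_lx n (i j : 'I_n) : (lx i <= lx j)%O = (i <= j)%N.
Proof. by []. Qed.
Lemma le_ly n (i j : 'I_n) : (ly i <= ly j)%O = (i <= j)%N.
Proof. by []. Qed.
Lemma le_lxly n (i j : 'I_n) : (lx i <= ly j)%O = (i <= j)%N.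
Proof. by []. Qed.
Lemma le_lylx n (i j : 'I_n) : (ly i <= lx j)%O = false.
Proof. by []. Qed.

Section LadderIntervals.
Variable n : nat.

Definition x_range (i j : 'I_n) : {set ladder n} :=
  [set lx a | a : 'I_n & (i <= a <= j)%N]%SET.
Definition y_range (k l : 'I_n) : {set ladder n} :=
  [set ly b | b : 'I_n & (k <= b <= l)%N]%SET.

Variant ladder_shape := ShapeXY of 'I_n & 'I_n & 'I_n & 'I_n
               | ShapeX of 'I_n & 'I_n
               | ShapeY of 'I_n & 'I_n.

Definition shape_ok (s : ladder_shape) : bool :=
  match s with
  | ShapeXY i j k l => [&& k <= i, i <= l & l <= j]%N
  | ShapeX i j => (i <= j)%N
  | ShapeY k l => (k <= l)%N
  end.

Definition shape_set (s : ladder_shape) : {set ladder n} :=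
  match s with
  | ShapeXY i j k l => x_range i j :|: y_range k l
  | ShapeX i j => x_range i j
  | ShapeY k l => y_range k l
  end.

Lemma mem_x_range i j (p : ladder n) :
  (p \in x_range i j) = ~~ p.1 && (i <= p.2 <= j)%N.
Proof.
apply/imsetP/idP => [[a] | ]; first by rewrite inE => ij ->.
by case: p => [[] a] //= ij; exists a; rewrite // inE.
Qed.

Lemma mem_y_range k l (p : ladder n) :
  (p \in y_range k l) = p.1 && (k <= p.2 <= l)%N.
Proof.
apply/imsetP/idP => [[a] | ]; first by rewrite inE => ij ->.
by case: p => [[] a] //= ij; exists a; rewrite // inE.
Qed.

Lemma cover_lx_ly (a b : 'I_n) : hasse_covers (lx a) (ly b) -> a = b.
Proof.
move=> /andP[/ltW ab /forallP/(_ (ly a))]; apply: contraNeq => neq_ab.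
rewrite !lt_neqAle le_lxly le_ly leqnn !andbT /=.
by rewrite -le_lxly ab andbT; apply: contra_neq neq_ab => -[].
Qed.

Lemma cover_ly_lx (a b : 'I_n) : ~~ hasse_covers (ly b) (lx a).
Proof. by apply/negP => /andP[/ltW]; rewrite le_lylx. Qed.

Lemma interval_rung (I : pinterval (ladder n)) (a b : 'I_n) :
    lx a \in (I : {set ladder n}) -> ly b \in (I : {set ladder n}) ->
  exists c : 'I_n,
    lx c \in (I : {set ladder n}) /\ ly c \in (I : {set ladder n}).
Proof.
move=> aI bI; have /and3P[_ _ /forall_inP cI] := ivalP I.
have /connectP[s] := forall_inP (cI _ aI) _ bI.
elim: s a aI => [//|q s IH] a aI /= /andP[/and3P[_ qI cov] ps] lasts.
case: q qI cov ps lasts => [[] c] qI cov ps lasts; last exact: IH qI ps lasts.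
exists c; split=> //; move: cov.
by rewrite (negPf (cover_ly_lx a c)) orbF => /cover_lx_ly <-.
Qed.

Lemma interval_row (I : pinterval (ladder n)) (v : bool) (a : 'I_n) :
    ((v, a) : ladder n) \in (I : {set ladder n}) ->
  exists i j : 'I_n,
    [/\ (i <= j)%N, ((v, i) : ladder n) \in (I : {set ladder n}),
        ((v, j) : ladder n) \in (I : {set ladder n})
      & forall c : 'I_n,
          (((v, c) : ladder n) \in (I : {set ladder n})) = (i <= c <= j)%N].
Proof.
move=> aI; pose r := [pred c | ((v, c) : ladder n) \in (I : {set ladder n})].
have [i iI imin] := @arg_minnP _ a r val aI.
have [j jI jmax] := @arg_maxnP _ a r val aI.
have ij : (i <= j)%N by exact: imin j jI.
exists i, j; split=> //.
move=> c; apply/idP/andP => [cI | [ic cj]].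
  by split; [exact: imin c cI | exact: jmax c cI].
by apply: (@interval_convex _ _ I (v, i) (v, c) (v, j)) => //;
  rewrite leEprod /= lexx.
Qed.

Lemma interval_shape (I : pinterval (ladder n)) :
  exists s, shape_ok s && ((I : {set ladder n}) == shape_set s).
Proof.
have [[a aI]|noX] := pselect (exists a, lx a \in (I : {set ladder n})).
  have [i [j [ij iI jI xE]]] := interval_row aI.
  have [[b bI]|noY] := pselect (exists b, ly b \in (I : {set ladder n})).
    have [k [l [kl kI lI yE]]] := interval_row bI.
    have [c [cxI cyI]] := interval_rung aI bI.
    move: (cxI) (cyI); rewrite xE yE => /andP[ic cj] /andP[kc cl].
    have il := leq_trans ic cl.
    exists (ShapeXY i j k l); apply/andP; split; last first.
      apply/eqP/finset.setP => -[[] e]; rewrite inE mem_x_range mem_y_range ?orbF.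
        exact: yE.
      exact: xE.
    have := @interval_convex _ _ I (lx i) (ly i) (ly l) iI lI (leqnn i) il.
    have := @interval_convex _ _ I (lx c) (lx l) (ly l) cxI lI cl (leqnn l).
    by rewrite xE yE /= il => /andP[_ ->] /andP[-> _].
  exists (ShapeX i j); rewrite /= ij; apply/eqP/finset.setP => -[[] e].
    by rewrite mem_x_range /=; apply/negP => eI; apply: noY; exists e.
  by rewrite mem_x_range; exact: xE.
have [[b bI]|noY] := pselect (exists b, ly b \in (I : {set ladder n})).
  have [k [l [kl kI lI yE]]] := interval_row bI.
  exists (ShapeY k l); rewrite /= kl; apply/eqP/finset.setP => -[[] e].
    by rewrite mem_y_range; exact: yE.
  by rewrite mem_y_range /=; apply/negP => eI; apply: noX; exists e.
have [[[] e] eI] := interval_neq0 I; first by case: noY; exists e.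
by case: noX; exists e.
Qed.

Lemma lx_shape_set s (c : 'I_n) :
  (lx c \in shape_set s) = match s with
                           | ShapeXY i j _ _ | ShapeX i j => (i <= c <= j)%N
                           | ShapeY _ _ => false
                           end.
Proof. by case: s => *; rewrite ?inE ?mem_x_range ?mem_y_range ?orbF. Qed.

Lemma ly_shape_set s (c : 'I_n) :
  (ly c \in shape_set s) = match s with
                           | ShapeXY _ _ k l | ShapeY k l => (k <= c <= l)%N
                           | ShapeX _ _ => false
                           end.
Proof. by case: s => *; rewrite ?inE ?mem_x_range ?mem_y_range. Qed.

Lemma shape_set_inj s t :
  shape_ok s -> shape_ok t -> shape_set s = shape_set t -> s = t.
Proof.
move=> s1 t1 E.
have Ex c : (lx c \in shape_set s) = (lx c \in shape_set t) by rewrite E.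
have Ey c : (ly c \in shape_set s) = (ly c \in shape_set t) by rewrite E.
have {Ex}Ex c := etrans (esym (lx_shape_set s c)) (etrans (Ex c) (lx_shape_set t c)).
have {Ey}Ey c := etrans (esym (ly_shape_set s c)) (etrans (Ey c) (ly_shape_set t c)).
have rng (i j i' j' : 'I_n) : (i <= j)%N -> (i' <= j')%N ->
    (forall c : 'I_n, (i <= c <= j)%N = (i' <= c <= j')%N) -> i = i' /\ j = j'.
  move=> ij ij' F; move: (F i) (F j) (F i') (F j').
  rewrite !leqnn ij ij' /= => /esym/andP[a _] /esym/andP[_ b] /andP[c _] /andP[_ e].
  by split; apply/val_inj/anti_leq; rewrite /= ?a ?b ?c ?e.
have nrng (i j : 'I_n) : (i <= j)%N ->
    ~ (forall c : 'I_n, (i <= c <= j)%N = false).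
  by move=> ij /(_ i); rewrite leqnn ij.
have lij (i j k l : 'I_n) : [&& k <= i, i <= l & l <= j]%N ->
    (i <= j)%N /\ (k <= l)%N.
  by move=> /and3P[ki il lj]; rewrite (leq_trans il lj) (leq_trans ki il).
case: s s1 Ex Ey {E} => [i j k l /lij[s1 s2]|i j s1|k l s1] Ex Ey;
  case: t t1 Ex Ey => [i' j' k' l' /lij[t1 t2]|i' j' t1|k' l' t1] Ex Ey.
- by have [-> ->] := rng _ _ _ _ s1 t1 Ex; have [-> ->] := rng _ _ _ _ s2 t2 Ey.
- by case: (nrng _ _ s2 Ey).
- by case: (nrng _ _ s1 Ex).
- by case: (nrng _ _ t2) => c; rewrite -Ey.
- by have [-> ->] := rng _ _ _ _ s1 t1 Ex.
- by case: (nrng _ _ s1 Ex).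
- by case: (nrng _ _ t1) => c; rewrite -Ex.
- by case: (nrng _ _ s1 Ey).
- by have [-> ->] := rng _ _ _ _ s1 t1 Ey.
Qed.

End LadderIntervals.

(* The quiver Q' : 1 <-- 2 --> 3 <-- 4 --> 5. *)
Variant zvertex := v1 | v2 | v3 | v4 | v5.
Variant zarrow : zvertex -> zvertex -> Type :=
| alpha1 : zarrow v2 v1
| alpha2 : zarrow v2 v3
| alpha3 : zarrow v4 v3
| alpha4 : zarrow v4 v5.
Definition zquiver : quiver := Quiver zarrow.

Section Compression.
Variables (k : fieldType) (n : nat).

(* The unique shape of I, see [shape_set_inj]. *)
Definition shape_of (I : pinterval (ladder n)) : ladder_shape n :=
  projT1 (cid (interval_shape I)).

Lemma shape_ofP (I : pinterval (ladder n)) :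
  shape_ok (shape_of I) /\ (I : {set ladder n}) = shape_set (shape_of I).
Proof. by rewrite /shape_of; case: cid => s /= /andP[? /eqP]. Qed.

Definition shape_xi (s : ladder_shape n) (v : zvertex) : ladder n :=
  match s, v with
  | ShapeXY i j k l, v1 => ly l
  | ShapeXY i j k l, v2 => ly k
  | ShapeXY i j k l, v3 => ly i
  | ShapeXY i j k l, v4 => lx i
  | ShapeXY i j k l, v5 => lx j
  | ShapeX i j, (v1 | v5) => lx j
  | ShapeX i j, (v2 | v3 | v4) => lx i
  | ShapeY k l, (v1 | v5) => ly l
  | ShapeY k l, (v2 | v3 | v4) => ly k
  end.

Definition xi (I : pinterval (ladder n)) : zvertex -> ladder n :=
  shape_xi (shape_of I).

Lemma xi_le (I : pinterval (ladder n)) (a b : zvertex) :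
  zarrow a b -> (xi I a <= xi I b)%O.
Proof.
rewrite /xi; have [ok _] := shape_ofP I; move: (shape_of I) ok => s ok.
case: s ok => [i j l m /and3P[li im mj]|i j ij|i j ij] [] /=;
  rewrite ?le_lx ?le_ly ?le_lxly //; first exact: leq_trans li im.
exact: leq_trans im mj.
Qed.

Definition F_xi (I : pinterval (ladder n)) :
    functor (path_cat zquiver) (poset_cat (ladder n)) :=
  @path_functor zquiver (poset_cat (ladder n)) (xi I) (@xi_le I).

Definition R_xi (I : pinterval (ladder n)) (M : rep k (poset_cat (ladder n))) :
    rep k (path_cat zquiver) :=
  precomp (F_xi I) M.

Definition c_xi (M : rep k (poset_cat (ladder n))) (I : pinterval (ladder n))
    : nat :=
  multiplicity (R_xi I (interval_rep k I)) (R_xi I M).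

Definition delta_xi (M : rep k (poset_cat (ladder n)))
    : {ffun pinterval (ladder n) -> int} :=
  [ffun J => \sum_(S : {set pinterval (ladder n)} | S \subset Cov J)
     (-1) ^+ #|S| * (c_xi M (join_above J S))%:Z].

End Compression.

(* Main.v *)
From HB Require Import structures.
From Stdlib Require List.
From mathcomp Require Import boolp classical_sets.
From mathcomp.multinomials Require Import freeg.
From mathcomp Require Import all_boot all_order all_algebra ring_quotient zify.
Require Import Defs.

Set Implicit Arguments.
Unset Strict Implicit.
Unset Printing Implicit Defensive.

Import Order.TTheory GRing.Theory Num.Theory.
Local Open Scope ring_scope.

(**
For a convex set D let S_D(M) be the space of maps into M from the module
that is k on D and 0 elsewhere.  An interval I of the ladder has at most two
maximal elements m1 and m2, so the number

  q_I(M) = dim S_I(M) - dim (S_{I - m1}(M) + S_{I - m2}(M))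

of maps V_I -> M that do not come from proper quotients of V_I is an alternating
sum of four dimensions, and is therefore additive on short exact sequences
whose epimorphism is a right approximation.  The sum of q_I(M) copies of each
V_I is a right approximation of M; since q_I(V_J) = 0 unless I is contained in
J, and q_I(V_I) = 1, additivity shows that the largest |I| with q_I nonzero
decreases from M to the kernel.  Hence interval resolutions are finite and the
classes [V_I] generate the relative Grothendieck group.

The multiplicity of the all-ones module in a zigzag module N is the rank of
lim N -> colim N.  For N = R_I(M) this rank is again an alternating sum of four
dimensions dim S_D(M), so the compressed multiplicities, and with them the
interval approximation delta, are integral combinations of the numbers
dim Hom(V_J, M).  Thus delta descends to the relative Grothendieck group, and
as delta(V_J) is the indicator function of J it is the coordinate isomorphism
for the generators [V_J].  The integer matrices expressing delta and dim-hom
through each other are inverse to one another, which gives the equivalence and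
the surjectivity of dim-hom.
*)

(** * Representations of a category *)

Section Homs.
Variables (k : fieldType) (C : category).
Implicit Types M N L K : rep k C.

Program Definition idh M : hom M M := @Hom k C M M (fun a => 1%:M) _.
Next Obligation. by rewrite mulmx1 mul1mx. Qed.

Program Definition hcomp L M N (g : hom L M) (f : hom M N) : hom L N :=
  @Hom k C L N (fun a => g a *m f a) _.
Next Obligation. by rewrite mulmxA hmap_nat -mulmxA hmap_nat mulmxA. Qed.

Program Definition hzero M N : hom M N := @Hom k C M N (fun=> 0) _.
Next Obligation. by rewrite mulmx0 mul0mx. Qed.

Program Definition hinl M N : hom M (dsum M N) :=
  @Hom k C M (dsum M N) (fun a => row_mx 1%:M 0) _.
Next Obligation.
by rewrite mul_row_block mul_mx_row !mul1mx !mul0mx !mulmx0 mulmx1 !addr0.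
Qed.

Program Definition hinr M N : hom N (dsum M N) :=
  @Hom k C N (dsum M N) (fun a => row_mx 0 1%:M) _.
Next Obligation.
by rewrite mul_row_block mul_mx_row !mul1mx !mul0mx !mulmx0 mulmx1 !add0r.
Qed.

Program Definition hfst M N : hom (dsum M N) M :=
  @Hom k C (dsum M N) M (fun a => col_mx 1%:M 0) _.
Next Obligation.
by rewrite mul_block_col mul_col_mx !mulmx1 !mulmx0 !mul1mx !mul0mx !addr0.
Qed.

Program Definition hsnd M N : hom (dsum M N) N :=
  @Hom k C (dsum M N) N (fun a => col_mx 0 1%:M) _.
Next Obligation.
by rewrite mul_block_col mul_col_mx !mulmx1 !mulmx0 !mul1mx !mul0mx !add0r.
Qed.

Program Definition hcopair M N L (f : hom M L) (g : hom N L)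
    : hom (dsum M N) L :=
  @Hom k C (dsum M N) L (fun a => col_mx (f a) (g a)) _.
Next Obligation.
by rewrite mul_block_col mul_col_mx !mul0mx addr0 add0r !hmap_nat.
Qed.

Lemma hinl_fst M N a : hinl M N a *m hfst M N a = 1%:M.
Proof. by rewrite /= mul_row_col mul1mx mul0mx addr0. Qed.

Lemma hinr_snd M N a : hinr M N a *m hsnd M N a = 1%:M.
Proof. by rewrite /= mul_row_col mul1mx mul0mx add0r. Qed.

Lemma hinl_snd M N a : hinl M N a *m hsnd M N a = 0.
Proof. by rewrite /= mul_row_col mul1mx mul0mx addr0. Qed.

Lemma hfst_inlD M N a :
  hfst M N a *m hinl M N a + hsnd M N a *m hinr M N a = 1%:M.
Proof.
rewrite /= !mul_col_row !mul1mx !mul0mx add_block_mx !addr0 add0r.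
by rewrite -scalar_mx_block.
Qed.

Lemma hinl_copair M N L (f : hom M L) (g : hom N L) a :
  hinl M N a *m hcopair f g a = f a.
Proof. by rewrite /= mul_row_col mul1mx mul0mx addr0. Qed.

Lemma iso_dim M N a : iso M N -> M a = N a.
Proof.
case=> f [g /(_ a)[fg gf]]; apply/eqP; rewrite eqn_leq; apply/andP; split.
  by rewrite -(mxrank1 k (M a)) -fg (leq_trans (mxrankM_maxr _ _)) ?rank_leq_row.
by rewrite -(mxrank1 k (N a)) -gf (leq_trans (mxrankM_maxr _ _)) ?rank_leq_row.
Qed.

Lemma zero_iso M N : is_zero M -> is_zero N -> iso M N.
Proof.
move=> M0 N0; exists (hzero M N), (hzero N M) => a.
by split; apply/matrixP => i; have := ltn_ord i; rewrite [X in (_ < X)%N](M0, N0).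
Qed.

Lemma mono_inj M N (i : hom M N) a m (u v : 'M_(m, M a)) :
  mono i -> u *m i a = v *m i a -> u = v.
Proof. by move=> /(_ a)/row_freeP[B iB] /(congr1 (mulmx^~ B)); rewrite -!mulmxA iB !mulmx1. Qed.

Lemma kernel_comp L M N (i : hom L M) (f : hom M N) a :
  is_kernel i f -> i a *m f a = 0.
Proof. by case=> _ /(_ a)/andP[/sub_kermxP]. Qed.

Lemma kernel_factor L M N (i : hom L M) (f : hom M N) a m (u : 'M_(m, M a)) :
  is_kernel i f -> u *m f a = 0 -> exists v, u = v *m i a.
Proof.
case=> _ /(_ a)/andP[_ le] /sub_kermxP uk.
exact/submxP/(submx_trans uk).
Qed.

Lemma kernel_mono L M N N' (i : hom L M) (f : hom M N) (g : hom N N') :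
  is_kernel i f -> mono g -> is_kernel i (hcomp f g).
Proof.
move=> ker mg; split=> [|a]; first exact: ker.1.
apply/andP; split.
  by apply/sub_kermxP; rewrite mulmxA (kernel_comp a ker) mul0mx.
have [v ->] : exists v, kermx (hcomp f g a) = v *m i a.
  apply: (kernel_factor ker); apply: (mono_inj mg).
  by rewrite -mulmxA mulmx_ker mul0mx.
exact: submxMl.
Qed.

(** Each kernel space is coordinatized by a row basis. As [i a] is injective, the structure maps [r]
    are forced by [ri], and functoriality follows by cancelling [i]. *)
Lemma kernel_exists M N (f : hom M N) : exists K (i : hom K M), is_kernel i f.
Proof.
pose d a : nat := \rank (kermx (f a)).
pose i a : 'M_(d a, M a) := row_base (kermx (f a)).
have if0 a : i a *m f a = 0 by apply/sub_kermxP; rewrite eq_row_base.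
have inj a : row_free (i a) by exact: row_base_free.
have fac a m (u : 'M_(m, M a)) : u *m f a = 0 -> u *m pinvmx (i a) *m i a = u.
  by move=> /sub_kermxP uk; rewrite mulmxKpV // eq_row_base.
have cancel a m (u v : 'M_(m, d a)) : u *m i a = v *m i a -> u = v.
  by move=> uv; apply: (row_free_inj (inj a)).
pose r a b (e : arr a b) := i a *m rmap M e *m pinvmx (i b).
have ri a b (e : arr a b) : r a b e *m i b = i a *m rmap M e.
  by apply: fac; rewrite -mulmxA hmap_nat mulmxA if0 mul0mx.
clearbody r.
have r1 a : r a a (idc a) = 1%:M.
  by apply: cancel; rewrite ri rmap1 mulmx1 mul1mx.
have rM a b c (e : arr a b) (e' : arr b c) :
    r a c (compc e e') = r a b e *m r b c e'.
  by apply: cancel; rewrite ri rmapM -[in RHS]mulmxA ri (mulmxA (i a)) (mulmxA (r a b e)) ri.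
pose K := Rep r1 rM.
exists K, (@Hom k C K M i ri); split=> // a /=.
by rewrite !eq_row_base submx_refl.
Qed.

(** The endomorphism [1%:M - f a *m s a] of M lands in the kernel of f, so it factors through [i];
    the factor [r] is the projection onto the second summand. *)
Lemma split_iso M N K (f : hom M N) (s : hom N M) (i : hom K M) :
  (forall a, s a *m f a = 1%:M) -> is_kernel i f -> iso M (dsum N K).
Proof.
move=> sf ker; have mi := ker.1.
have ex : forall a, exists v, 1%:M - f a *m s a = v *m i a.
  move=> a; apply: (kernel_factor ker).
  by rewrite mulmxBl mul1mx -mulmxA sf mulmx1 subrr.
pose r a := sval (cid (ex a)).
have ri a : 1%:M - f a *m s a = r a *m i a := svalP (cid (ex a)).
clearbody r.
have rnat (a b : C) (e : arr a b) : rmap M e *m r b = r a *m rmap K e.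
  apply: (mono_inj mi); rewrite -!mulmxA hmap_nat -ri mulmxA -ri.
  by rewrite mulmxBl mulmxBr mul1mx mulmx1 mulmxA hmap_nat -!mulmxA hmap_nat.
pose rh : hom M K := Hom rnat.
have if0 a : i a *m f a = 0 := kernel_comp a ker.
have ir a : i a *m r a = 1%:M.
  by apply: (mono_inj mi); rewrite -mulmxA -ri mulmxBr mulmxA if0 mul0mx subr0 mul1mx mulmx1.
have sr a : s a *m r a = 0.
  by apply: (mono_inj mi); rewrite -mulmxA -ri mulmxBr mulmxA sf mul1mx mulmx1 subrr mul0mx.
have natl (a b : C) (e : arr a b) :
    rmap M e *m row_mx (f b) (r b) = row_mx (f a) (r a) *m rmap (dsum N K) e.
  by rewrite mul_mx_row mul_row_block !mulmx0 add0r addr0 hmap_nat rnat.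
exists (@Hom k C M (dsum N K) _ natl), (hcopair s i) => a /=.
split; first by rewrite mul_row_col -ri addrC subrK.
by rewrite mul_col_row sf if0 ir sr -scalar_mx_block.
Qed.

Lemma epi_section M N (f : hom M N) (s : hom N M) :
  (forall a, s a *m f a = 1%:M) -> epi f.
Proof. by move=> sf a; apply/row_fullP; exists (s a). Qed.

Lemma dsum_ses M N : short_exact (hinl M N) (hsnd M N).
Proof.
split; last by apply: (@epi_section _ _ _ (hinr M N)) => a; apply: hinr_snd.
split=> a; first by apply/row_freeP; exists (hfst M N a); apply: hinl_fst.
apply/andP; split; first by apply/sub_kermxP; apply: hinl_snd.
apply/submxP; exists (kermx (hsnd M N a) *m hfst M N a).
rewrite -mulmxA -[LHS]mulmx1 -hfst_inlD mulmxDr [X in _ + X]mulmxA mulmx_ker.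
by rewrite mul0mx addr0.
Qed.

(** Puts an isomorphism into a split exact sequence with zero kernel, so that a function that is
    additive on split sequences and zero on the zero module is seen to be an isomorphism
    invariant. *)
Lemma iso_ses M N : iso M N ->
  exists (g : hom zero_rep M) (f : hom M N) (s : hom N M),
    short_exact g f /\ forall a, s a *m f a = 1%:M.
Proof.
case=> f [s fs]; exists (hzero _ _), f, s; split=> [|a]; last exact: (fs a).2.
split; last by apply: (@epi_section _ _ _ s) => a; exact: (fs a).2.
split=> a; first by rewrite /row_free eqn_leq rank_leq_row.
rewrite sub0mx /=; have [/(congr1 (mulmx (kermx (f a)))) E _] := fs a.
by rewrite mulmxA mulmx_ker mul0mx mulmx1 in E; rewrite -E sub0mx.
Qed.

Lemma zero_ses : short_exact (hzero zero_rep zero_rep) (hzero zero_rep zero_rep).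
Proof.
split; last by move=> a; rewrite /row_full eqn_leq rank_leq_col.
split=> a; first by rewrite /row_free eqn_leq rank_leq_row.
by rewrite [hzero _ _ a]flatmx0 [kermx _]flatmx0 submx_refl.
Qed.

(** * Maps out of finite direct sums *)

Section Copairing.
Variables (T : Type) (X : T -> rep k C) (M : rep k C).

Definition sum_of (s : seq {t : T & hom (X t) M}) : rep k C :=
  dsums [seq X t | t <- [seq tag u | u <- s]].

Fixpoint copairing s : hom (sum_of s) M :=
  if s is u :: s' then hcopair (tagged u) (copairing s')
  else hzero zero_rep M.

Lemma copairing_in s u : List.In u s ->
  exists j : hom (X (tag u)) (sum_of s),
    forall a, j a *m copairing s a = tagged u a.
Proof.
elim: s => [//|u' s IH] /= [->|/IH[j jE]].
  by exists (hinl _ (sum_of s)) => a; apply: hinl_copair.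
exists (hcomp j (hinr _ (sum_of s))) => a.
by rewrite /= -mulmxA mul_row_col mul0mx mul1mx add0r jE.
Qed.

End Copairing.

Lemma dsums_lift (T : Type) (X : T -> rep k C) (s : seq T) M N (f : hom M N) :
  (forall t (g : hom (X t) N), exists h : hom (X t) M,
     forall a, h a *m f a = g a) ->
  forall g : hom (dsums [seq X t | t <- s]) N,
    exists h : hom (dsums [seq X t | t <- s]) M, forall a, h a *m f a = g a.
Proof.
move=> lift; elim: s => [|t s IH] g.
  by exists (hzero _ _) => a; rewrite [LHS]flatmx0 [RHS]flatmx0.
have [h1 h1E] := lift t (hcomp (hinl _ _) g).
have [h2 h2E] := IH (hcomp (hinr _ _) g).
exists (hcopair h1 h2) => a; rewrite /= mul_col_mx h1E h2E /=.
rewrite -[RHS]mul1mx -hfst_inlD mulmxDl /= -!mulmxA !mul_col_mx !mul1mx !mul0mx.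
by rewrite add_col_mx addr0 add0r.
Qed.

(** A map out of a summand is extended by zero to the whole direct sum, lifted there term by term,
    and restricted again; so the approximation property need only be tested on the generators. *)
Lemma in_add_lift (T : finType) (X : T -> rep k C) M N (f : hom M N) :
  (forall t (g : hom (X t) N), exists h : hom (X t) M,
     forall a, h a *m f a = g a) ->
  forall Y, in_add X Y -> forall g : hom Y N,
    exists h : hom Y M, forall a, h a *m f a = g a.
Proof.
move=> lift Y [Z [s [u [v uv]]]] g.
have [h hE] := dsums_lift lift (hcomp v (hcomp (hfst Y Z) g)).
exists (hcomp (hinl Y Z) (hcomp u h)) => a.
have /= := hE a; rewrite -!mulmxA => ->.
by rewrite (mulmxA (u a)) (uv a).1 mul1mx mulmxA hinl_fst mul1mx.
Qed.

Lemma dsum_zero_iso M : iso (dsum M zero_rep) M.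
Proof.
exists (hfst _ _), (hinl _ _) => a; split; last exact: hinl_fst.
rewrite -[RHS]hfst_inlD (_ : hinr M zero_rep a = 0) ?mulmx0 ?addr0 //.
by rewrite [LHS]flatmx0.
Qed.

Lemma dsums_in_add (T : finType) (X : T -> rep k C) (s : seq T) :
  in_add X (dsums [seq X t | t <- s]).
Proof. exists zero_rep, s; exact: dsum_zero_iso. Qed.

Lemma iso_in_add (T : finType) (X : T -> rep k C) (t : T) : in_add X (X t).
Proof.
exists zero_rep, [:: t]; exact: iso_refl.
Qed.

End Homs.

(** * Sections of a module over a convex set *)

Section Components.
Context {d : Order.disp_t} (P : finPOrderType d).
Implicit Types (D : {set P}) (I J : pinterval P).

Lemma convex_setP D :
  reflect (forall x y z, x \in D -> z \in D -> (x <= y)%O -> (y <= z)%O -> y \in D)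
          (convex_set D).
Proof.
apply: (iffP forall_inP) => [cD x y z xD zD xy yz | cD x xD].
  by move: (forall_inP (cD x xD) z zD) => /forallP/(_ y); rewrite xy yz.
by apply/forall_inP => z zD; apply/forallP => y; apply/implyP => /andP[]; apply: cD.
Qed.

Lemma hasse_edge_sym D : symmetric (hasse_edge_in D).
Proof. by move=> x y; rewrite /hasse_edge_in orbC; case: (x \in D); rewrite ?andbF. Qed.

Lemma hasse_connect_sym D : connect_sym (hasse_edge_in D).
Proof. exact: sym_connect_sym (hasse_edge_sym D). Qed.

(** Induction on the size of the segment from p to q: if q does not cover p, an intermediate point,
    which lies in D by convexity, splits the segment into two smaller ones. *)
Lemma convex_connect D p q :
  convex_set D -> p \in D -> q \in D -> (p <= q)%O ->
  connect (hasse_edge_in D) p q.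
Proof.
move=> /convex_setP cD.
have [m] := ubnP #|[set z | (p <= z <= q)%O]|.
elim: m p q => // m IH p q; rewrite ltnS => lem pD qD.
rewrite le_eqVlt => /orP[/eqP-> //|pq].
have [pqc|] := boolP (hasse_covers p q).
  by apply: connect1; rewrite /hasse_edge_in pD qD pqc.
rewrite /hasse_covers pq /= negb_forall => /existsP[z]; rewrite negbK => /andP[pz zq].
have zD : z \in D := cD _ _ _ pD qD (ltW pz) (ltW zq).
apply: (connect_trans (y := z)); apply: IH => //; try exact: ltW.
  apply: leq_trans lem; apply: proper_card; apply/properP; split.
    by apply/fintype.subsetP => t; rewrite !inE => /andP[-> /le_trans->] //; exact: ltW.
  by exists q; rewrite !inE ?lexx ?(ltW pq) //= (lt_geF zq).
apply: leq_trans lem; apply: proper_card; apply/properP; split.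
  by apply/fintype.subsetP => t; rewrite !inE => /andP[/(le_trans (ltW pz))-> ->].
by exists p; rewrite !inE ?lexx ?(ltW pq) //= (lt_geF pz).
Qed.

Lemma interval_convex_set I : convex_set I.
Proof. by case/and3P: (ivalP I). Qed.

Lemma interval_connected I x y : x \in (I : {set P}) -> y \in (I : {set P}) ->
  connect (hasse_edge_in I) x y.
Proof. by case/and3P: (ivalP I) => _ _ /forall_inP cI xI; exact: (forall_inP (cI x xI)). Qed.

Definition incomparable_sets (D1 D2 : {set P}) : Prop :=
  forall p q, p \in D1 -> q \in D2 -> ~~ (p <= q)%O /\ ~~ (q <= p)%O.

(** The interval is the component of x0 in the Hasse graph of D. Comparable points of D are joined
    by a path in D, so points of distinct components are incomparable. *)
Lemma convex_component D x0 : convex_set D -> x0 \in D ->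
  exists I : pinterval P,
    [/\ (I : {set P}) \subset D, x0 \in (I : {set P}),
        incomparable_sets I (D :\: I) & convex_set (D :\: I)].
Proof.
move=> cD x0D; pose e := hasse_edge_in D.
pose C := [set q in D | connect e x0 q].
have CD : C \subset D by apply/fintype.subsetP => q; rewrite inE => /andP[].
have x0C : x0 \in C by rewrite inE x0D connect0.
have memC p q : p \in C -> q \in D -> connect e p q -> q \in C.
  by rewrite !inE => /andP[_ cp] -> /(connect_trans cp).
have inc : incomparable_sets C (D :\: C).
  move=> p q pC; rewrite inE => /andP[qC qD]; have pD := fintype.subsetP CD p pC.
  split; apply: contra qC => le; apply: (memC p) => //.
    exact: convex_connect.
  by rewrite hasse_connect_sym; exact: convex_connect.
have cC : convex_set C.
  apply/convex_setP => x y z xC zC xy yz.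
  have [xD zD] := (fintype.subsetP CD x xC, fintype.subsetP CD z zC).
  have yD : y \in D by move/convex_setP: cD; apply; first exact: xD; first exact: zD.
  by apply: (memC x) => //; exact: convex_connect.
have conC : connected_set C.
  apply/forall_inP => x xC; apply/forall_inP => y yC.
  have : connect e x y.
    move: xC yC; rewrite !inE => /andP[_]; rewrite hasse_connect_sym => cx /andP[_].
    exact: connect_trans.
  (* A path in D that starts in C stays in C. *)
  case/connectP => s ps ->.
  elim: s x xC ps => [x _ _|z s IH x xC /= /andP[xz ps]]; first exact: connect0.
  have zC : z \in C by apply: (memC x) (connect1 xz) => //; case/and3P: xz.
  apply: connect_trans (IH z zC ps); apply: connect1.
  by case/and3P: xz => _ _ xz; rewrite /hasse_edge_in xC zC.
have iC : is_interval C.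
  by rewrite /is_interval cC conC !andbT; apply/finset.set0Pn; exists x0.
exists (PInterval iC); split => //=.
apply/convex_setP => x y z; rewrite !finset.in_setD => /andP[xC xD] /andP[zC zD] xy yz.
have yD : y \in D by move/convex_setP: cD; apply; first exact: xD; first exact: zD.
rewrite yD andbT; apply/negP => yC.
have xDC : x \in D :\: C by rewrite finset.in_setD xC.
by have [_] := inc y x yC xDC; rewrite xy.
Qed.

Lemma upset_diff_convex (U Z : {set P}) :
  (forall p q, p \in U -> (p <= q)%O -> q \in U) ->
  (forall p q, p \in Z -> (p <= q)%O -> q \in Z) -> convex_set (U :\: Z).
Proof.
move=> uU uZ; apply/convex_setP => x y z; rewrite !inE.
move=> /andP[_ xU] /andP[zZ _] xy yz; rewrite (uU x) // andbT.
by apply: contra zZ => yZ; exact: (uZ y).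
Qed.

End Components.

Section Sections.
Variables (k : fieldType).
Context {d : Order.disp_t} (P : finPOrderType d).
Implicit Types (M N L : rep k (poset_cat P)) (D : {set P}) (I J : pinterval P).

(* The product of the spaces M p is coordinatized by pairs of a point p and *)
(* an index below dim M p.                                                  *)
Definition total M := {ffun {p : P & 'I_(M p)} -> k^o}.

Section Total.
Variable M : rep k (poset_cat P).

Definition ev (p : P) (w : total M) : 'rV[k]_(M p) :=
  \row_j w (Tagged (fun p => 'I_(M p)) j).

Lemma ev_is_linear p : linear (ev p).
Proof. by move=> c u v; apply/rowP => j; rewrite !mxE !ffunE. Qed.

HB.instance Definition _ p :=
  GRing.isLinear.Build k (total M) 'rV[k]_(M p) _ (ev p) (ev_is_linear p).

Definition of_ev (m : forall p : P, 'rV[k]_(M p)) : total M :=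
  [ffun t => m (tag t) ord0 (tagged t)].

Lemma ev_of m p : ev p (of_ev m) = m p.
Proof. by apply/rowP => j; rewrite !mxE ffunE. Qed.

Lemma ev_inj (v w : total M) : (forall p, ev p v = ev p w) -> v = w.
Proof.
by move=> vw; apply/ffunP => -[p j]; move/rowP: (vw p) => /(_ j); rewrite !mxE.
Qed.

Definition section_defect (t : {pq : P * P | (pq.1 <= pq.2)%O}) (w : total M) :
    'rV[k]_(M (val t).2) :=
  ev (val t).1 w *m @rmap _ _ M (val t).1 (val t).2 (valP t) - ev (val t).2 w.

Lemma section_defect_is_linear t : linear (section_defect t).
Proof.
move=> c u v; rewrite /section_defect !linearP mulmxDl -scalemxAl.
by rewrite scalerBr scalerN addrACA.
Qed.

HB.instance Definition _ t :=
  GRing.isLinear.Build k (total M) _ _ (section_defect t)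
    (section_defect_is_linear t).

(* For convex D these are the maps into M from the module that is k on D    *)
(* and 0 elsewhere.                                                         *)
Definition sections D : {vspace total M} :=
  ((\bigcap_(p | p \notin D) lker (linfun (ev p))) :&:
   (\bigcap_(t : {pq : P * P | (pq.1 <= pq.2)%O} | (val t).1 \in D)
      lker (linfun (section_defect t))))%VS.

(** An arrow leaving D says that the value at its source is killed; an arrow entering D imposes
    nothing, as the module on D is zero at its source. *)
Lemma sectionsP D w :
  w \in sections D <->
  (forall p, p \notin D -> ev p w = 0) /\
  (forall (p q : P) (pq : (p <= q)%O), p \in D ->
     ev p w *m @rmap _ _ M p q pq = ev q w).
Proof.
rewrite memv_cap; split=> [/andP[/subv_bigcapP w0 /subv_bigcapP wc] | [w0 wc]].
  split=> [p pD | p q pq pD].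
    by have := w0 p pD; rewrite -memvE memv_ker lfunE => /eqP.
  have := wc (Sub (p, q) (pq : ((p, q).1 <= (p, q).2)%O)) pD.
  rewrite -memvE memv_ker lfunE /section_defect /= subr_eq0 => /eqP <-.
  by congr (_ *m rmap M _); exact: bool_irrelevance.
apply/andP; split; apply/subv_bigcapP.
  by move=> p pD; rewrite -memvE memv_ker lfunE /= w0.
move=> t tD; rewrite -memvE memv_ker lfunE /=.
by rewrite /section_defect wc // subrr.
Qed.

End Total.

Arguments ev {M} p w.

Section Push.
Variables (M N : rep k (poset_cat P)) (f : hom M N).

Definition push (w : total M) : total N := of_ev (fun p => ev p w *m f p).

Lemma ev_push p w : ev p (push w) = ev p w *m f p.
Proof. exact: ev_of. Qed.

Lemma push_is_linear : linear push.
Proof.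
move=> c u v; apply: ev_inj => p; rewrite ev_push !linearP /=.
by rewrite mulmxDl -scalemxAl !ev_push.
Qed.

HB.instance Definition _ :=
  GRing.isLinear.Build k (total M) (total N) _ push push_is_linear.

Lemma push_sections D w : w \in sections M D -> push w \in sections N D.
Proof.
move=> /sectionsP[w0 wc]; apply/sectionsP; split=> [p pD | p q pq pD].
  by rewrite ev_push w0 ?mul0mx.
by rewrite !ev_push -mulmxA -hmap_nat mulmxA wc.
Qed.

Definition lifts D : Prop :=
  forall w, w \in sections N D -> exists2 v, v \in sections M D & push v = w.

End Push.

Lemma sections0 M : sections M finset.set0 = 0%VS.
Proof.
apply/vspaceP => w; rewrite memv0; apply/idP/eqP => [/sectionsP[w0 _] | ->].
  by apply: ev_inj => p; rewrite w0 ?inE // linear0.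
exact: mem0v.
Qed.

(** A downset of D carries a quotient of the module on D, and maps out of a quotient are among the
    maps out of the module. *)
Lemma sections_downset M (D' D : {set P}) : D' \subset D ->
  (forall p q, p \in D' -> q \in D -> (q <= p)%O -> q \in D') ->
  (sections M D' <= sections M D)%VS.
Proof.
move=> /fintype.subsetP sD dn; apply/subvP => w /sectionsP[w0 wc]; apply/sectionsP.
split=> [p pD | p q pq pD]; first by apply: w0; apply: contra pD => /sD.
have [pD'|pD'] := boolP (p \in D'); first exact: wc.
rewrite w0 // mul0mx w0 //; apply: contra pD' => qD'; exact: (dn q).
Qed.

Lemma sections_supp M (D' D : {set P}) w : D' \subset D -> w \in sections M D ->
  (forall p, p \in D :\: D' -> ev p w = 0) -> w \in sections M D'.
Proof.
move=> /fintype.subsetP sD /sectionsP[w0 wc] wD'; apply/sectionsP.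
split=> [p pD | p q pq pD]; last by apply: wc; exact: sD.
have [pD1|pD1] := boolP (p \in D); last exact: w0.
by apply: wD'; rewrite inE pD pD1.
Qed.

Lemma sections_cap M (D D1 D2 : {set P}) : D1 \subset D -> D2 \subset D ->
  (forall p q, p \in D1 -> q \in D -> (q <= p)%O -> q \in D1) ->
  (forall p q, p \in D2 -> q \in D -> (q <= p)%O -> q \in D2) ->
  (sections M D1 :&: sections M D2)%VS = sections M (D1 :&: D2)%SET.
Proof.
move=> s1 s2 d1 d2; apply/eqP; rewrite eqEsubv subv_cap; apply/and3P; split.
- apply/subvP => w; rewrite memv_cap => /andP[w1 /sectionsP[w2 _]].
  apply: (sections_supp (D := D1)) => //; first exact: finset.subsetIl.
  by move=> p; rewrite !inE => /andP[+ p1]; rewrite p1 => /w2.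
- apply: sections_downset => [|p q]; first exact: finset.subsetIl.
  rewrite !inE => /andP[p1 p2] q1 qp; rewrite q1 /=.
  by apply: (d2 p) => //; exact: (fintype.subsetP s1).
apply: sections_downset => [|p q]; first exact: finset.subsetIr.
rewrite !inE => /andP[p1 p2] q2 qp; rewrite q2 andbT.
by apply: (d1 p) => //; exact: (fintype.subsetP s2).
Qed.

Section ShortExact.
Variables (L M N : rep k (poset_cat P)) (g : hom L M) (f : hom M N).
Hypothesis gf : is_kernel g f.

(** Taking sections over D is left exact; the hypothesis [lifts f D] supplies surjectivity on the
    right. *)
Lemma dim_sections_ses D : lifts f D ->
  \dim (sections M D) = (\dim (sections L D) + \dim (sections N D))%N.
Proof.
move=> lift; rewrite -(limg_ker_dim (linfun (push f)) (sections M D)); congr (_ + _)%N.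
  have <- : (linfun (push g) @: sections L D)%VS =
            (sections M D :&: lker (linfun (push f)))%VS.
    apply/vspaceP => w; rewrite memv_cap memv_ker lfunE /=.
    apply/memv_imgP/andP => [[v vD ->] | [wD /eqP fw]].
      rewrite lfunE push_sections //; split=> //; apply/eqP/ev_inj => p.
      by rewrite !ev_push -mulmxA (kernel_comp (p : poset_cat P) gf) mulmx0 linear0.
    have ex p : exists v, ev p w = v *m g p.
      apply: (kernel_factor gf); rewrite -ev_push fw; exact: linear0.
    pose v := of_ev (fun p => sval (cid (ex p))).
    have vE p : ev p v *m g p = ev p w by rewrite ev_of; case: cid.
    exists v; last by apply: ev_inj => p; rewrite lfunE ev_push vE.
    have /sectionsP[w0 wc] := wD; apply/sectionsP; split=> [p pD | p q pq pD].
      by apply: (mono_inj gf.1); rewrite vE mul0mx w0.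
    by apply: (mono_inj gf.1); rewrite -mulmxA hmap_nat mulmxA !vE wc.
  apply: limg_dim_eq; apply/eqP; rewrite -subv0; apply/subvP => v.
  rewrite memv_cap memv_ker lfunE memv0 => /andP[_ /eqP gv].
  apply/eqP/ev_inj => p; apply: (mono_inj gf.1).
  by rewrite -ev_push gv !linear0 mul0mx.
congr (\dim _); apply/vspaceP => w; apply/memv_imgP/idP => [[v vD ->] | wD].
  by rewrite lfunE push_sections.
by have [v vD <-] := lift w wD; exists v; rewrite ?lfunE.
Qed.

End ShortExact.

(** With no relations between D1 and D2, cutting a section off to either part leaves a section, so
    the two parts are independent. *)
Lemma sections_disjoint M (D1 D2 : {set P}) : incomparable_sets D1 D2 ->
  (sections M D1 + sections M D2)%VS = sections M (D1 :|: D2)%SET /\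
  (sections M D1 :&: sections M D2)%VS = 0%VS.
Proof.
move=> inc.
have sub1 : (sections M D1 <= sections M (D1 :|: D2)%SET)%VS.
  apply: sections_downset => [|p q p1]; first exact: finset.subsetUl.
  by rewrite inE => /orP[//|q2] qp; have [_] := inc p q p1 q2; rewrite qp.
have sub2 : (sections M D2 <= sections M (D1 :|: D2)%SET)%VS.
  apply: sections_downset => [|p q p2]; first exact: finset.subsetUr.
  by rewrite inE => /orP[q1|//] qp; have [] := inc q p q1 p2; rewrite qp.
have disj p : p \in D1 -> p \notin D2.
  by move=> p1; apply/negP => p2; have [] := inc p p p1 p2; rewrite lexx.
split; apply/eqP; last first.
  rewrite -subv0; apply/subvP => w; rewrite memv_cap memv0 => /andP[].
  move=> /sectionsP[w1 _] /sectionsP[w2 _]; apply/eqP/ev_inj => p; rewrite linear0.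
  by have [p1|] := boolP (p \in D1); [apply/w2/disj | exact: w1].
rewrite eqEsubv subv_add sub1 sub2 /=; apply/subvP => w /sectionsP[w0 wc].
pose w1 : total M := of_ev (fun p => if p \in D1 then ev p w else 0).
pose w2 : total M := of_ev (fun p => if p \in D2 then ev p w else 0).
have -> : w = w1 + w2.
  apply: ev_inj => p; rewrite linearD /= !ev_of.
  have [p1|p1] := boolP (p \in D1); first by rewrite (negPf (disj p p1)) addr0.
  rewrite add0r; case: ifPn => // p2; apply: w0.
  by rewrite inE negb_or p1.
apply: memv_add; apply/sectionsP; split=> [p pD | p q pq pD]; rewrite !ev_of.
- by rewrite (negPf pD).
- rewrite pD wc ?inE ?pD //; case: ifPn => // q1; apply: w0; rewrite inE negb_or q1.
  by apply/negP => q2; have [] := inc p q pD q2; rewrite pq.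
- by rewrite (negPf pD).
- rewrite pD wc ?inE ?pD ?orbT //; case: ifPn => // q2; apply: w0; rewrite inE negb_or q2 andbT.
  by apply/negP => q1; have [_] := inc q p q1 pD; rewrite pq.
Qed.

Lemma convex_ind (Q : {set P} -> Prop) :
  Q finset.set0 ->
  (forall D (I : pinterval P), (I : {set P}) \subset D -> convex_set D ->
     incomparable_sets I (D :\: I) -> convex_set (D :\: I) ->
     Q (D :\: I) -> Q D) ->
  forall D, convex_set D -> Q D.
Proof.
move=> Q0 QS D; have [m] := ubnP #|D|.
elim: m D => // m IH D; rewrite ltnS => lem cD.
have [->//|/finset.set0Pn[x xD]] := eqVneq D finset.set0.
have [I [ID xI inc cDI]] := convex_component cD xD.
apply: (QS D I) => //; apply: IH => //.
apply: leq_trans lem; rewrite finset.cardsD (finset.setIidPr ID) ltn_subrL.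
by rewrite !card_gt0; apply/andP; split; apply/finset.set0Pn; exists x.
Qed.

(** A convex set is a union of pairwise incomparable intervals, split off one at a time. The
    coefficients [a] depend on D and not on M. *)
Lemma dim_sections_components D : convex_set D ->
  exists a : {ffun pinterval P -> nat}, forall M,
    \dim (sections M D) = (\sum_J a J * \dim (sections M J))%N.
Proof.
move: D; apply: convex_ind => [|D I ID cD inc cDI [a aE]].
  exists [ffun=> 0%N] => M; rewrite sections0 dimv0 big1 // => J _.
  by rewrite ffunE mul0n.
exists [ffun J => ((J == I) + a J)%N] => M.
have [sE cE] := sections_disjoint M inc.
have DE : (I :|: (D :\: I))%SET = D.
  by rewrite -{1}(finset.setIidPr ID) finset.setID.
have := dimv_sum_cap (sections M I) (sections M (D :\: I)).
rewrite sE cE dimv0 addn0 DE aE => ->.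
under [RHS]eq_bigr do rewrite ffunE mulnDl.
rewrite big_split; congr (_ + _)%N.
by rewrite (bigD1 I) //= eqxx mul1n big1 ?addn0 // => J /negPf->.
Qed.

End Sections.
Arguments ev {k d P M} p w.

(** * Maps out of interval modules *)

Section IntervalHoms.
Variables (k : fieldType).
Context {d : Order.disp_t} (P : finPOrderType d).
Implicit Types (M N L : rep k (poset_cat P)) (D : {set P}) (I J : pinterval P).
Local Notation V := (interval_rep k).

(** The generator of V_I at p, with [ones_col] the dual functional. Both are empty matrices when p
    is outside I, so that [ones_colK] holds at every point. *)
Definition ones_row I (p : P) : 'rV[k]_(interval_dim I p) := const_mx 1.
Definition ones_col I (p : P) : 'cV[k]_(interval_dim I p) := const_mx 1.

Lemma ones_colK I p : ones_col I p *m ones_row I p = 1%:M.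
Proof.
rewrite -interval_map1; apply/matrixP => i j.
by rewrite !mxE big_ord1 !mxE mulr1.
Qed.

Lemma ones_rowK I p : p \in (I : {set P}) -> ones_row I p *m ones_col I p = 1%:M.
Proof.
move=> pI; apply/matrixP => i j; rewrite !mxE.
under eq_bigr do rewrite !mxE mulr1.
by rewrite sumr_const card_ord !ord1 /interval_dim pI.
Qed.

Lemma interval_dim0 I p m (A B : 'M[k]_(interval_dim I p, m)) :
  p \notin (I : {set P}) -> A = B.
Proof.
move=> /negPf pI; apply/matrixP => i; have := ltn_ord i.
by rewrite [X in (_ < X)%N]/interval_dim pI.
Qed.

Lemma ones_row_map I (p q : P) : p \in (I : {set P}) ->
  ones_row I p *m (const_mx 1 : 'M[k]_(interval_dim I p, interval_dim I q))
  = ones_row I q.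
Proof.
move=> pI; apply/matrixP => i j; rewrite !mxE.
under eq_bigr do rewrite !mxE mulr1.
by rewrite sumr_const card_ord /interval_dim pI.
Qed.

Lemma ones_col_map I (p q : P) : q \in (I : {set P}) ->
  (const_mx 1 : 'M[k]_(interval_dim I p, interval_dim I q)) *m ones_col I q
  = ones_col I p.
Proof.
move=> qI; apply/matrixP => i j; rewrite !mxE.
under eq_bigr do rewrite !mxE mulr1.
by rewrite sumr_const card_ord /interval_dim qI.
Qed.

Definition hom_section I M (f : hom (V I) M) : total M :=
  of_ev (fun p => ones_row I p *m f p).

Lemma ev_hom_section I M (f : hom (V I) M) p :
  ev p (hom_section f) = ones_row I p *m f p.
Proof. exact: ev_of. Qed.

Lemma hom_section_inj I M (f g : hom (V I) M) :
  hom_section f = hom_section g -> forall p, f p = g p.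
Proof.
move=> fg p; rewrite -[f p]mul1mx -[g p]mul1mx -ones_colK -!mulmxA.
by rewrite -!ev_hom_section fg.
Qed.

Lemma hom_section_mem I M (f : hom (V I) M) : hom_section f \in sections M I.
Proof.
apply/sectionsP; split=> [p pI | p q pq pI]; rewrite !ev_hom_section.
  by rewrite (interval_dim0 (f p) 0 pI) mulmx0.
by rewrite -mulmxA -(@hmap_nat _ _ _ _ f p q pq) mulmxA ones_row_map.
Qed.

(** The membership condition stands inside the existential so that [section_hom] is defined on all
    of [total M]; outside the sections any map serves. *)
Lemma section_hom_exists I M w : exists f : hom (V I) M,
  w \in sections M I -> hom_section f = w.
Proof.
have [/sectionsP[w0 wc]|] := boolP (w \in sections M I); last first.
  by move=> _; exists (hzero _ _).
pose f (p : P) := ones_col I p *m ev p w.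
have nat (p q : P) (pq : (p <= q)%O) :
    @rmap _ _ (V I) p q pq *m f q = f p *m @rmap _ _ M p q pq.
  have [pI|/interval_dim0] := boolP (p \in (I : {set P})); last by apply.
  rewrite /f -[RHS]mulmxA wc //; have [qI|qI] := boolP (q \in (I : {set P})).
    by rewrite mulmxA ones_col_map.
  by rewrite w0 // !mulmx0.
exists (@Hom k (poset_cat P) (V I) M f nat) => _.
apply: ev_inj => p; rewrite ev_hom_section /= /f mulmxA.
have [pI|pI] := boolP (p \in (I : {set P})); first by rewrite ones_rowK ?mul1mx.
by rewrite w0 ?mulmx0.
Qed.

Definition section_hom I M (w : total M) : hom (V I) M :=
  sval (cid (section_hom_exists I w)).

Lemma section_homK I M (w : total M) :
  w \in sections M I -> hom_section (section_hom I w) = w.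
Proof. exact: svalP (cid (section_hom_exists I w)). Qed.

Lemma hom_section_comp I M N (g : hom (V I) M) (f : hom M N) :
  hom_section (hcomp g f) = push f (hom_section g).
Proof. by apply: ev_inj => p; rewrite ev_push !ev_hom_section mulmxA. Qed.

Lemma lifts_hom I M N (f : hom M N) : lifts f I ->
  forall g : hom (V I) N, exists h : hom (V I) M, forall a, h a *m f a = g a.
Proof.
move=> lift g; have [v vI fv] := lift _ (hom_section_mem g).
exists (section_hom I v); apply: (hom_section_inj (f := hcomp _ f)).
by rewrite hom_section_comp section_homK.
Qed.

Lemma hom_lifts I M N (f : hom M N) :
  (forall g : hom (V I) N, exists h : hom (V I) M, forall a, h a *m f a = g a) ->
  lifts f I.
Proof.
move=> lift w wI; have [h hE] := lift (section_hom I w).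
exists (hom_section h); first exact: hom_section_mem.
apply: ev_inj => p.
by rewrite ev_push ev_hom_section -mulmxA hE -ev_hom_section section_homK.
Qed.

Lemma hom_section_sum I M m (b : 'I_m -> hom (V I) M) (c : 'I_m -> k) p :
  ev p (\sum_i c i *: hom_section (b i)) = ones_row I p *m \sum_i c i *: b i p.
Proof.
rewrite linear_sum mulmx_sumr; apply: eq_bigr => i _.
by rewrite linearZ /= -scalemxAr ev_hom_section.
Qed.

(** Uniqueness of the coefficients of the zero map is freeness of the corresponding sections, and
    existence of coefficients is spanning. *)
Lemma hom_basis_sections I M m (b : 'I_m -> hom (V I) M) :
  hom_basis b -> m = \dim (sections M I).
Proof.
move=> bb; pose X := [tuple hom_section (b i) | i < m].
have XE (c : 'I_m -> k) : \sum_(i < m) c i *: X`_i = \sum_i c i *: hom_section (b i).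
  by apply: eq_bigr => i _; rewrite -tnth_nth tnth_mktuple.
apply/esym/(@size_basis _ _ _ _ X); rewrite basisEfree size_tuple; apply/and3P; split.
- apply/freeP => c; rewrite XE => c0 i; have [e [_ uniq]] := bb (hzero _ _).
  have ce : e = \row_i c i.
    apply: uniq => p; under eq_bigr do rewrite mxE.
    by rewrite -[RHS]mul1mx -ones_colK -mulmxA -hom_section_sum c0 linear0 mulmx0.
  have e0 : e = 0.
    by apply: uniq => p; rewrite big1 // => j _; rewrite mxE scale0r.
  by move: ce; rewrite e0 => /rowP/(_ i); rewrite !mxE => <-.
- apply/span_subvP => w /tnthP[i ->]; rewrite tnth_mktuple.
  exact: hom_section_mem.
rewrite -(size_tuple X).
have -> : (\dim (sections M I) <= size X)%N = true; last by [].
apply/idP; apply: leq_trans (dim_span X); apply: dimvS; apply/subvP => w wI.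
have [c [cE _]] := bb (section_hom I w).
have -> : w = \sum_i c ord0 i *: hom_section (b i).
  rewrite -[LHS](section_homK wI); apply: ev_inj => p.
  by rewrite hom_section_sum ev_hom_section cE.
rewrite -XE; apply: rpred_sum => i _; apply/rpredZ/memv_span.
by rewrite mem_nth // size_tuple.
Qed.

Lemma hom_basis_exists I M :
  exists b : 'I_(\dim (sections M I)) -> hom (V I) M, hom_basis b.
Proof.
pose X := vbasis (sections M I); have Xb := vbasisP (sections M I).
pose b (i : 'I_(\dim (sections M I))) := section_hom I X`_i.
have bE i : hom_section (b i) = X`_i.
  by apply/section_homK/vbasis_mem/mem_nth; rewrite size_tuple.
exists b => f; exists (\row_i coord X i (hom_section f)); split=> [p | c cE].
  rewrite -[LHS]mul1mx -ones_colK -mulmxA -ev_hom_section.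
  rewrite [in LHS](coord_basis Xb (hom_section_mem f)).
  under [in RHS]eq_bigr do rewrite mxE.
  rewrite -[RHS]mul1mx -ones_colK -mulmxA -hom_section_sum.
  by under [in RHS]eq_bigr do rewrite bE.
have -> : hom_section f = \sum_i c ord0 i *: X`_i.
  apply: ev_inj => p; rewrite ev_hom_section cE -hom_section_sum.
  by under eq_bigr do rewrite bE.
by apply/rowP => i; rewrite mxE coord_sum_free ?(basis_free Xb).
Qed.

Lemma hom_dim_sections I M : hom_dim (V I) M = \dim (sections M I).
Proof.
apply: xget_unique => [|m [b bb]]; first exact: hom_basis_exists.
exact: hom_basis_sections bb.
Qed.

Lemma right_approx_lifts I M N (f : hom M N) :
  right_approx V f -> lifts f I.
Proof.
case=> _ lift; apply: hom_lifts => g; apply: lift; exact: iso_in_add.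
Qed.

Lemma right_approx_dim I L M N (g : hom L M) (f : hom M N) :
  is_kernel g f -> right_approx V f ->
  \dim (sections M I) = (\dim (sections L I) + \dim (sections N I))%N.
Proof. by move=> ker fa; exact: (dim_sections_ses ker (@right_approx_lifts I _ _ _ fa)). Qed.

Lemma split_lifts D M N (f : hom M N) (s : hom N M) :
  (forall a, s a *m f a = 1%:M) -> lifts f D.
Proof.
move=> sf w wD; exists (push s w); first exact: push_sections.
by apply: ev_inj => p; rewrite !ev_push -mulmxA sf mulmx1.
Qed.

Lemma dim_sections_zero D : \dim (sections (zero_rep : rep k (poset_cat P)) D) = 0%N.
Proof.
apply/eqP; rewrite dimv_eq0 -subv0; apply/subvP => w _; rewrite memv0.
by apply/eqP/ev_inj => p; apply/rowP => -[].
Qed.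

(** The coordinate of such a section is constant along Hasse edges inside I, hence on all of I by
    connectedness. *)
Lemma sections_self I : sections (V I) I = <[hom_section (idh (V I))]>%VS.
Proof.
have oneE p : ev p (hom_section (idh (V I))) = ones_row I p.
  by rewrite ev_hom_section mulmx1.
apply/vspaceP => w; apply/idP/vlineP => [wI | [c ->]]; last first.
  exact/rpredZ/hom_section_mem.
have /sectionsP[w0 wc] := wI; pose phi p := (ev p w *m ones_col I p) ord0 ord0.
have phiE p : ev p w = phi p *: ones_row I p.
  by rewrite -mul_scalar_mx -mx11_scalar -mulmxA ones_colK mulmx1.
have phi_le p q : p \in (I : {set P}) -> q \in (I : {set P}) -> (p <= q)%O ->
    phi p = phi q.
  by move=> pI qI pq; rewrite /phi -(wc p q pq) // -mulmxA ones_col_map.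
have [x xI] := interval_neq0 I.
have phi_const p : p \in (I : {set P}) -> phi p = phi x.
  move=> pI; have /connectP[s] := interval_connected pI xI.
  elim: s p pI => [p _ _ ->|q s IH p pI /= /andP[/and3P[_ qI cov] ps] last] //.
  rewrite -(IH q qI ps last); case/orP: cov => /andP[/ltW le _]; first exact: phi_le.
  by apply/esym/phi_le.
exists (phi x); apply: ev_inj => p; rewrite linearZ /= oneE.
have [pI|pI] := boolP (p \in (I : {set P})); first by rewrite phiE phi_const.
by rewrite w0 // -[ones_row I p]mulmx1 (interval_dim0 1%:M 0 pI) mulmx0 scaler0.
Qed.

Lemma ones_row_neq0 I p : p \in (I : {set P}) -> ones_row I p != 0.
Proof.
move=> pI; apply/eqP => /(congr1 (mulmx^~ (ones_col I p))).
by rewrite ones_rowK // mul0mx => /eqP; rewrite oner_eq0.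
Qed.

Lemma interval_endo I (f : hom (V I) (V I)) : exists c, forall p, f p = c%:M.
Proof.
have := hom_section_mem f; rewrite sections_self => /vlineP[c fc]; exists c => p.
rewrite -[f p]mul1mx -ones_colK -mulmxA -ev_hom_section fc linearZ /=.
by rewrite ev_hom_section mulmx1 -scalemxAr ones_colK scalemx1.
Qed.

(** The idempotents [e1] and [e2] of a decomposition are scalars with product zero, so one of them
    vanishes; the identity of the corresponding summand factors through it. *)
Lemma interval_indecomposable I : indecomposable (V I).
Proof.
have [x xI] := interval_neq0 I; split=> [/(_ x)|N1 N2 [f [g fg]]].
  by rewrite /= /interval_dim xI.
pose e1 := hcomp f (hcomp (hfst N1 N2) (hcomp (hinl N1 N2) g)).
pose e2 := hcomp f (hcomp (hsnd N1 N2) (hcomp (hinr N1 N2) g)).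
have [c1 e1E] := interval_endo e1; have [c2 e2E] := interval_endo e2.
have inl p : hinl N1 N2 p *m g p *m e1 p *m f p *m hfst N1 N2 p = 1%:M.
  rewrite /e1 [hcomp _ _ p]/= -!mulmxA (mulmxA (g p)) (fg p).2 mul1mx.
  rewrite !mulmxA (hinl_fst N1 N2 p) mul1mx.
  by rewrite -!mulmxA (mulmxA (g p)) (fg p).2 mul1mx hinl_fst.
have inr p : hinr N1 N2 p *m g p *m e2 p *m f p *m hsnd N1 N2 p = 1%:M.
  rewrite /e2 [hcomp _ _ p]/= -!mulmxA (mulmxA (g p)) (fg p).2 mul1mx.
  rewrite !mulmxA (hinr_snd N1 N2 p) mul1mx.
  by rewrite -!mulmxA (mulmxA (g p)) (fg p).2 mul1mx hinr_snd.
have one0 m : (1%:M : 'M[k]_m) = 0 -> m = 0%N.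
  by case: m => // m /matrixP/(_ ord0 ord0)/eqP; rewrite !mxE oner_eq0.
have e12 p : e1 p *m e2 p = 0.
  rewrite /= -!mulmxA (mulmxA (g p)) (fg p).2 mul1mx (mulmxA (row_mx 1%:M 0)).
  by rewrite (hinl_snd N1 N2 p) mul0mx !mulmx0.
have : c1 * c2 = 0.
  move: (e12 x); rewrite e1E e2E -scalar_mxM => e0.
  have := congr1 (mulmx (ones_row I x) \o mulmx^~ (ones_col I x)) e0.
  rewrite /= mul_scalar_mx mul0mx mulmx0 -scalemxAr ones_rowK //.
  by move/matrixP/(_ ord0 ord0); rewrite !mxE mulr1.
move/eqP; rewrite mulf_eq0 => /orP[] /eqP c0; [left|right] => p; apply: one0.
  by rewrite -inl e1E c0 raddf0 mulmx0 !mul0mx.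
by rewrite -inr e2E c0 raddf0 mulmx0 !mul0mx.
Qed.

Lemma interval_iso_inj I J : iso (V I) (V J) -> I = J.
Proof.
move=> IJ; apply/val_inj/finset.setP => p; have := iso_dim (p : poset_cat P) IJ.
by rewrite /= /interval_dim; do 2!case: (_ \in _).
Qed.

End IntervalHoms.

(** * Interval covers and interval resolutions *)

Lemma In_allpairs (A : eqType) (B : A -> eqType) (T : Type) (h : forall x, B x -> T)
    (r1 : seq A) (r2 : forall x, seq (B x)) x (y : B x) :
  x \in r1 -> y \in r2 x -> List.In (h x y) [seq h x y | x <- r1, y <- r2 x].
Proof.
move=> + yr; elim: r1 => [//|z r1 IH]; rewrite inE => /orP[/eqP E|xr] /=; apply/List.in_or_app.
  left; rewrite -E; elim: (r2 x) yr => [//|z' r2' IH2]; rewrite inE => /orP[/eqP->|yr] /=.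
    by left.
  by right; exact: IH2.
by right; exact: IH.
Qed.

Section Tops.
Context {d : Order.disp_t} (P : finPOrderType d).
Implicit Types (D : {set P}) (I J : pinterval P).

(** Lists the maximal elements of I, the same point being entered twice when there is only one. *)
Definition tops (I : pinterval P) (t : P * P) : Prop :=
  [/\ t.1 \in (I : {set P}), t.2 \in (I : {set P}),
      forall p, p \in (I : {set P}) -> (t.1 <= p)%O -> p = t.1,
      forall p, p \in (I : {set P}) -> (t.2 <= p)%O -> p = t.2
    & forall p, p \in (I : {set P}) -> (p <= t.1)%O || (p <= t.2)%O].

Definition maximal_in I m := forall p, p \in (I : {set P}) -> (m <= p)%O -> p = m.

Lemma convex_del_max I m : maximal_in I m -> convex_set (I :\ m).
Proof.
move=> mx; apply/convex_setP => x y z; rewrite !inE => /andP[xm xI] /andP[zm zI] xy yz.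
rewrite (interval_convex xI zI xy yz) andbT; apply: contra zm => /eqP ym.
by apply/eqP/mx => //; rewrite -ym.
Qed.

Lemma downset_del_max I m : maximal_in I m ->
  forall p q, p \in I :\ m -> q \in (I : {set P}) -> (q <= p)%O -> q \in I :\ m.
Proof.
move=> mx p q; rewrite !inE => /andP[pm pI] qI qp; rewrite qI andbT.
by apply: contra pm => /eqP qm; apply/eqP/mx => //; rewrite -qm.
Qed.

Variable (k : fieldType).
Implicit Types (M N L K : rep k (poset_cat P)).
Local Notation V := (interval_rep k).

Lemma sections_del_max M I m : maximal_in I m ->
  (sections M (I :\ m)%SET <= sections M I)%VS.
Proof. by move=> mx; apply: sections_downset (downset_del_max mx); exact: finset.subD1set. Qed.

Variable top : pinterval P -> P * P.
Hypothesis topP : forall I, tops I (top I).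

Lemma top1_max I : maximal_in I (top I).1. Proof. by case: (topP I). Qed.
Lemma top2_max I : maximal_in I (top I).2. Proof. by case: (topP I). Qed.

(* The maps V_I -> M that factor through a sum of proper quotients of V_I. *)
Definition decomposable_sections M I : {vspace total M} :=
  (sections M (I :\ (top I).1)%SET + sections M (I :\ (top I).2)%SET)%VS.

Lemma decomposable_sub M I : (decomposable_sections M I <= sections M I)%VS.
Proof. by rewrite subv_add !sections_del_max //; (exact: top1_max || exact: top2_max). Qed.

(** A chosen complement: its basis indexes the copies of V_I that go into the cover of M. *)
Definition new_sections M I : {vspace total M} :=
  (sections M I :\: decomposable_sections M I)%VS.

(** The number q_I(M). *)
Definition newdim M I : nat := \dim (new_sections M I).

(** Inclusion-exclusion for a sum of two subspaces, with the negative terms moved to the left so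
    that no truncated subtraction occurs. *)
Lemma newdimE M I :
  (newdim M I + \dim (sections M (I :\ (top I).1)) + \dim (sections M (I :\ (top I).2))
   = \dim (sections M I) + \dim (sections M ((I :\ (top I).1) :&: (I :\ (top I).2))))%N.
Proof.
rewrite -addnA -dimv_sum_cap (sections_cap _ _ _ (downset_del_max (@top1_max I))
  (downset_del_max (@top2_max I))) ?finset.subD1set //.
rewrite addnA; congr (_ + _)%N.
rewrite -(dimv_cap_compl (sections M I) (decomposable_sections M I)) addnC.
by rewrite (capv_idPr (decomposable_sub M I)).
Qed.

Lemma convex_del_tops I : convex_set ((I :\ (top I).1) :&: (I :\ (top I).2)).
Proof.
have /convex_setP c1 := convex_del_max (@top1_max I).
have /convex_setP c2 := convex_del_max (@top2_max I).
apply/convex_setP => x y z; rewrite !(finset.in_setI) => /andP[x1 x2] /andP[z1 z2] xy yz.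
by rewrite (c1 x y z) // (c2 x y z).
Qed.

(** Lifting is demanded over convex sets rather than intervals because deleting tops can disconnect
    an interval. *)
Lemma newdim_ses L M N (g : hom L M) (f : hom M N) I :
  is_kernel g f -> (forall D, convex_set D -> lifts f D) ->
  newdim M I = (newdim L I + newdim N I)%N.
Proof.
move=> ker lift; have := newdimE M I; have := newdimE L I; have := newdimE N I.
have dimE D : convex_set D -> _ := fun cD => dim_sections_ses ker (lift D cD).
rewrite !dimE; first lia.
- exact: convex_del_tops.
- exact: interval_convex_set.
- exact/convex_del_max/top2_max.
- exact/convex_del_max/top1_max.
Qed.

Lemma newdim_dsum M N I : newdim (dsum M N) I = (newdim M I + newdim N I)%N.
Proof.
apply: (newdim_ses _ (dsum_ses M N).1) => D _.
by apply: (@split_lifts _ _ _ _ _ _ _ (hinr M N)) => a; apply: hinr_snd.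
Qed.

Lemma newdim_dsums (s : seq (pinterval P)) I :
  newdim (dsums [seq V t | t <- s]) I = (\sum_(t <- s) newdim (V t) I)%N.
Proof.
elim: s => [|t s IH]; last by rewrite big_cons newdim_dsum IH.
rewrite big_nil; apply/eqP; rewrite -leqn0 -(dim_sections_zero k I).
by apply: dimvS; exact: diffvSl.
Qed.

(** If a point p of I is missing from J, a map from V_I to V_J vanishes at p, hence at a top above
    p, and so factors through I without that top: every section is decomposable. *)
Lemma newdim_interval_neq0 I J : newdim (V J) I != 0%N -> (I : {set P}) \subset J.
Proof.
apply: contraR => /subsetPn[p pI pJ]; rewrite dimv_eq0 diffv_eq0.
apply/subvP => w wI; have /sectionsP[_ wc] := wI.
have wp : ev p w = 0 by rewrite -[ev p w]mulmx1 (interval_dim0 1%:M 0 pJ) mulmx0.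
have del m : (p <= m)%O -> m \in (I : {set P}) -> w \in sections (V J) (I :\ m).
  move=> pm mI; apply: sections_supp wI _; first exact: finset.subD1set.
  move=> q; rewrite !inE => /andP[+ qI]; rewrite qI andbT negbK => /eqP->.
  by rewrite -(wc p m pm pI) wp mul0mx.
have [t1 t2 _ _ /(_ p pI)/orP[le|le]] := topP I.
  exact: (subvP (addvSl _ _)) (del _ le t1).
exact: (subvP (addvSr _ _)) (del _ le t2).
Qed.

(** All endomorphisms of V_I are scalars, and a scalar that vanishes at a top of I is zero; so no
    nonzero section is decomposable, and the identity spans the new ones. *)
Lemma newdim_self I : newdim (V I) I = 1%N.
Proof.
have dec0 m : m \in (I : {set P}) -> sections (V I) (I :\ m) = 0%VS \/ ~ maximal_in I m.
  move=> mI; have [mx|] := pselect (maximal_in I m); [left | by right].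
  apply/eqP; rewrite -subv0; apply/subvP => w wm; rewrite memv0.
  have := subvP (sections_del_max (V I) mx) _ wm; rewrite sections_self.
  case/vlineP => c wE; have /sectionsP[/(_ m)] := wm.
  rewrite !inE eqxx => /(_ isT); rewrite wE linearZ /= ev_hom_section mulmx1.
  by move/eqP; rewrite scaler_eq0 (negPf (ones_row_neq0 _ mI)) orbF => /eqP->; rewrite scale0r.
have [t1 t2 m1 m2 _] := topP I.
have d0 : decomposable_sections (V I) I = 0%VS.
  rewrite /decomposable_sections; have [->|//] := dec0 _ t1.
  by have [->|//] := dec0 _ t2; rewrite addv0.
rewrite -[RHS]/(nat_of_bool true) /newdim /new_sections.
have := dimv_cap_compl (sections (V I) I) (decomposable_sections (V I) I).
rewrite d0 capv0 dimv0 add0n => ->; rewrite sections_self dim_vline.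
congr nat_of_bool; apply/eqP => h0.
have := ev_hom_section (idh (V I)) (top I).1; rewrite h0 linear0 mulmx1.
by move/esym/eqP; rewrite (negPf (ones_row_neq0 _ t1)).
Qed.

(** Induction on the size of D. A disconnected D is treated by splitting off a component; over an
    interval every section is a new one plus sections over two smaller convex sets. *)
Lemma lifts_of_new M N (f : hom M N) :
  (forall I w, w \in new_sections N I -> exists2 v, v \in sections M I & push f v = w) ->
  forall D, convex_set D -> lifts f D.
Proof.
move=> new D; have [m] := ubnP #|D|.
elim: m D => // m IH D; rewrite ltnS => lem cD.
have liftD (U1 U2 W : {vspace total N}) (X1 X2 X : {vspace total M}) :
    (forall w, w \in U1 -> exists2 v, v \in X1 & push f v = w) ->
    (forall w, w \in U2 -> exists2 v, v \in X2 & push f v = w) ->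
    (W <= U1 + U2)%VS -> (X1 <= X)%VS -> (X2 <= X)%VS ->
    forall w, w \in W -> exists2 v, v \in X & push f v = w.
  move=> l1 l2 sW s1 s2 w /(subvP sW)/memv_addP[w1 /l1[v1 v1X <-] [w2 /l2[v2 v2X <-] ->]].
  exists (v1 + v2); last exact: linearD.
  by apply: rpredD; [exact: (subvP s1) | exact: (subvP s2)].
have [->|/finset.set0Pn[x xD]] := eqVneq D finset.set0.
  by move=> w; rewrite !sections0 memv0 => /eqP->; exists 0; rewrite ?mem0v ?linear0.
have [I [ID xI inc cDI]] := convex_component cD xD.
(* Either D is the single interval I, or I and its complement in D are both smaller than D. *)
have [ltI|] := ltnP #|I| #|D|; last first.
  move=> leI; have {leI} ED : (I : {set P}) = D by apply/eqP; rewrite eqEcard ID.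
  subst D.
  have lt0 t : t \in (I : {set P}) -> (#|(I :\ t)%SET| < m)%N.
    by move=> tI; move: lem; rewrite (cardsD1 t I) tI.
  have [t1 t2 m1 m2 _] := topP I.
  have dec : forall w, w \in decomposable_sections N I ->
      exists2 v, v \in decomposable_sections M I & push f v = w.
    apply: (liftD (sections N (I :\ (top I).1)) (sections N (I :\ (top I).2)) _
             (sections M (I :\ (top I).1)) (sections M (I :\ (top I).2))).
    - by apply: IH; [exact: lt0 | exact: convex_del_max].
    - by apply: IH; [exact: lt0 | exact: convex_del_max].
    - exact: subvv.
    - exact: addvSl.
    - exact: addvSr.
  apply: (liftD _ _ _ _ _ _ (new I) dec _ (subvv _) (decomposable_sub M I)).
  by rewrite addv_diff addvSl.
have [sN _] := sections_disjoint N inc; have [sM _] := sections_disjoint M inc.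
have DE : (I :|: (D :\: I))%SET = D.
  by rewrite -{1}(finset.setIidPr ID) finset.setID.
have ltDI : (#|(D :\: I)%SET| < m)%N.
  apply: leq_trans lem; rewrite finset.cardsD (finset.setIidPr ID) ltn_subrL.
  by rewrite !card_gt0; apply/andP; split; apply/finset.set0Pn; exists x.
apply: (liftD _ _ _ _ _ _ (IH I _ (interval_convex_set I)) (IH _ ltDI cDI)).
- exact: leq_trans ltI lem.
- by rewrite sN DE subvv.
- by rewrite -[in X in (_ <= X)%VS]DE -sM addvSl.
- by rewrite -[in X in (_ <= X)%VS]DE -sM addvSr.
Qed.

Definition cover_family M : seq {t : pinterval P & hom (V t) M} :=
  [seq Tagged (fun t => hom (V t) M) (section_hom J w) |
     J <- enum {: pinterval P}, w <- vbasis (new_sections M J)].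

Definition cover_index M : seq (pinterval P) := [seq tag u | u <- cover_family M].

Definition cover M : rep k (poset_cat P) := dsums [seq V t | t <- cover_index M].

Definition cover_map M : hom (cover M) M := copairing (cover_family M).

(** By [lifts_of_new] only new sections need lifting, and each basis vector of [new_sections] comes
    from the inclusion of its own summand. *)
Lemma cover_lifts M D : convex_set D -> lifts (cover_map M) D.
Proof.
move: D; apply: lifts_of_new => I w wI.
have : (new_sections M I <= linfun (push (cover_map M)) @: sections (cover M) I)%VS.
  rewrite -(span_basis (vbasisP (new_sections M I))); apply/span_subvP => {w wI} w wb.
  have wI : w \in sections M I := subvP (diffvSl _ _) _ (vbasis_mem wb).
  pose u := Tagged (fun t => hom (V t) M) (section_hom I w).
  have us : List.In u (cover_family M).
    by apply: In_allpairs; rewrite ?mem_enum.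
  have [j jE] := copairing_in us.
  apply/memv_imgP; exists (hom_section j); first exact: hom_section_mem.
  rewrite lfunE /= -hom_section_comp -[LHS](section_homK wI).
  by apply: ev_inj => p; rewrite !ev_hom_section /= -jE.
move=> /subvP sub; have /memv_imgP[v vI ->] := sub w wI.
by exists v; rewrite ?lfunE.
Qed.

Lemma cover_approx M : right_approx V (cover_map M).
Proof.
split; first exact: dsums_in_add.
apply: in_add_lift => I; apply: lifts_hom; apply: cover_lifts.
exact: interval_convex_set.
Qed.

(** The module on the principal upset of p represents evaluation at p, so lifting over this upset is
    surjectivity at p. *)
Lemma upset_lifts_epi M N (f : hom M N) :
  (forall D, convex_set D -> lifts f D) -> epi f.
Proof.
move=> lift p; rewrite -sub1mx; apply/row_subP => i; move: (row i _) => v.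
pose D := [set q | (p <= q)%O] : {set P}.
have cD : convex_set D.
  apply/convex_setP => x y z; rewrite !inE => px _ xy _; exact: le_trans px xy.
(* The case distinction provides the proof of p <= q that [rmap] takes as argument. *)
pose w : total N := of_ev (fun q =>
  if pselect (p <= q)%O is left pq then v *m @rmap _ _ N p q pq else 0).
have wE q (pq : (p <= q)%O) : ev q w = v *m @rmap _ _ N p q pq.
  rewrite ev_of; case: pselect => // pq'; congr (_ *m rmap N _); exact: bool_irrelevance.
have [|u _ uw] := lift D cD w.
  apply/sectionsP; split=> [q|q r qr].
    by rewrite inE => pq; rewrite ev_of; case: pselect => // pq'; rewrite pq' in pq.
  rewrite inE => pq; rewrite (wE _ pq) (wE _ (le_trans pq qr)) -mulmxA -rmapM.
  by congr (_ *m rmap N _); exact: bool_irrelevance.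
apply/submxP; exists (ev p u); rewrite -ev_push uw (wE p (lexx p)).
by rewrite [rmap _ _](@rmap1 k (poset_cat P) N p) mulmx1.
Qed.

Lemma newdim_cover M I :
  newdim (cover M) I = (\sum_J newdim M J * newdim (V J) I)%N.
Proof.
rewrite newdim_dsums big_map big_allpairs_dep big_enum; apply: eq_bigr => J _.
by rewrite /= big_const_seq count_predT size_tuple iter_addn_0 mulnC.
Qed.

(* The termination measure: passing to the kernel of the cover lowers the *)
(* bound by one, see [bounded_kernel].                                      *)
Definition bounded s M : Prop := forall I, (s <= #|I|)%N -> newdim M I = 0%N.

Lemma bounded_card M : bounded #|P|.+1 M.
Proof. by move=> I; rewrite ltnNge max_card. Qed.

Lemma bounded0_cover M : bounded 0 M -> cover_index M = [::].
Proof.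
move=> b0; apply/nilP; rewrite /nilp size_map size_allpairs_dep sumnE big_map big1_seq // => I _.
by rewrite size_tuple; exact: b0.
Qed.

(** In q_I of the cover the term J = I is q_I(M), which additivity cancels. Any other J that could
    contribute strictly contains I, so it has at least s + 1 points and q_J(M) = 0. *)
Lemma bounded_kernel s M K (i : hom K (cover M)) :
  is_kernel i (cover_map M) -> bounded s.+1 M -> bounded s K.
Proof.
move=> ker bM I sI.
have := newdim_ses I ker (@cover_lifts M).
rewrite newdim_cover (bigD1 I) //= newdim_self muln1 big1 ?addn0; first lia.
move=> J JI; apply/eqP; rewrite muln_eq0; case: eqP => //= /eqP MJ.
apply/eqP; apply: contraNeq JI => /newdim_interval_neq0 IJ; apply/eqP/val_inj/eqP.
rewrite eq_sym eqEcard IJ /=; apply: leq_trans sI; rewrite -ltnS ltnNge.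
by apply: contra MJ => lt; apply/eqP/bM.
Qed.

Lemma cover_ses M K (i : hom K (cover M)) :
  is_kernel i (cover_map M) -> short_exact i (cover_map M).
Proof. by move=> ker; split=> //; apply: upset_lifts_epi; exact: cover_lifts. Qed.

Lemma bounded0_zero M : bounded 0 M -> is_zero M.
Proof.
move=> b0 p; have /eqP <- : row_full (cover_map M p).
  exact: upset_lifts_epi (@cover_lifts M) p.
apply/eqP; rewrite -leqn0 (leq_trans (rank_leq_row _)) //.
by rewrite /cover bounded0_cover.
Qed.

(** The bound of [bounded_card] drops by one with each passage to the kernel of the cover, and at
    bound zero the module is zero. *)
Lemma interval_induction (Q : rep k (poset_cat P) -> Prop) :
  (forall M, is_zero M -> Q M) ->
  (forall M K (i : hom K (cover M)), short_exact i (cover_map M) -> Q K -> Q M) ->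
  forall M, Q M.
Proof.
move=> base step M; have := @bounded_card M; move: (_.+1) => s.
elim: s M => [|s IH] M bM; first exact/base/bounded0_zero.
have [K [i ker]] := kernel_exists (cover_map M).
by apply: (step M K i (cover_ses ker)); apply: IH; exact: bounded_kernel ker bM.
Qed.

(** The cover is an epimorphism, hence splits over a projective module. *)
Lemma interval_projective (Q : rep k (poset_cat P)) : projective Q -> in_add V Q.
Proof.
move=> pQ; have [K [i ker]] := kernel_exists (cover_map Q).
have [h hE] := pQ _ _ (cover_map Q) (idh Q) (cover_ses ker).2.
exists K, (cover_index Q); exact/iso_sym/(split_iso hE ker).
Qed.

Lemma interval_finite_resolution M : has_finite_resolution V M.
Proof.
pose syz N := sval (cid (kernel_exists (cover_map N))).
pose inc N : hom (syz N) (cover N) := sval (cid (svalP (cid (kernel_exists (cover_map N))))).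
have ker N : is_kernel (inc N) (cover_map N) := svalP (cid (svalP (cid (kernel_exists (cover_map N))))).
pose O i := iter i syz M.
(* The syzygy [O i] is bounded by [#|P|.+1 - i], so the terms beyond index [#|P|] vanish. Each
   differential is a cover followed by the inclusion of a syzygy. *)
exists #|P|, (fun i => cover (O i)), (cover_map M),
  (fun i => hcomp (cover_map (O i.+1)) (inc (O i))).
split=> [i|i lti|||i]; [exact: dsums_in_add | | exact: cover_approx | |].
  have b0 : bounded 0 (O i).
    have: bounded (#|P|.+1 - i) (O i).
      elim: i {lti} => [|i IH]; first by rewrite subn0; exact: bounded_card.
      move=> I le; have: bounded (#|P|.+1 - i.+1).+1 (O i) by move=> J lej; apply: IH; lia.
      by move/(bounded_kernel (ker (O i))); exact.
    by move: lti; rewrite -subn_eq0 => /eqP->.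
  by move=> a; rewrite /cover bounded0_cover.
  by exists (O 1%N), (inc M), (cover_map (O 1%N)); split=> //; [exact: ker | exact: cover_approx].
(* The inclusion of a syzygy is mono, so a differential has the same kernel as the cover it begins
   with. *)
exists (O i.+2), (inc (O i.+1)), (cover_map (O i.+2)); split=> //; last exact: cover_approx.
exact: kernel_mono (ker _) (ker _).1.
Qed.

End Tops.

(** * Multiplicities and zigzag modules *)

Section Decomposition.
Variables (k : fieldType) (C : category).
Implicit Types M N L K : rep k C.

Lemma dsum_iso M N N' : iso N N' -> iso (dsum M N) (dsum M N').
Proof.
case=> f [g fg].
exists (hcopair (hinl M N') (hcomp f (hinr M N'))), (hcopair (hinl M N) (hcomp g (hinr M N))) => a.
have [fga gfa] := fg a.
by split; rewrite /= !mul_mx_row !mulmx0 !mulmx1 -!block_mxEv mulmx_block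
  !mulmx1 !mulmx0 !mul0mx !addr0 !add0r (fga, gfa) -scalar_mx_block.
Qed.

Lemma retract_summand M N (s : hom N M) (f : hom M N) :
  (forall a, s a *m f a = 1%:M) -> exists K, iso M (dsum N K).
Proof.
by move=> sf; have [K [i ker]] := kernel_exists f; exists K; apply: split_iso sf ker.
Qed.

Variables (T : finType) (o : T -> C).
Hypothesis o_surj : forall a, exists t, o t = a.

(** A total dimension along a surjective enumeration of the objects; additivity and positivity on
    nonzero modules make it an induction measure. *)
Definition rep_size M := (\sum_t M (o t))%N.

Lemma rep_size_gt0 M : ~ is_zero M -> (0 < rep_size M)%N.
Proof.
move=> nz; rewrite lt0n; apply/negP; rewrite sum_nat_eq0 => /forallP M0; apply: nz => a.
by have [t <-] := o_surj a; exact/eqP/M0.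
Qed.

Lemma rep_size_dsum M N L : iso M (dsum N L) -> rep_size M = (rep_size N + rep_size L)%N.
Proof.
by move=> e; rewrite /rep_size -big_split; apply: eq_bigr => t _; exact: iso_dim (o t) e.
Qed.

Lemma indecomposable_summand M : ~ is_zero M ->
  exists N K, indecomposable N /\ iso M (dsum N K).
Proof.
have [m] := ubnP (rep_size M); elim: m M => // m IH M; rewrite ltnS => lem nzM.
have [dec|ndec] := pselect (indecomposable M).
  have [|K MK] := @retract_summand M M (idh M) (idh M); last by exists M, K.
  by move=> a; rewrite mulmx1.
have [N1 [N2 [e [nz1 nz2]]]] : exists N1 N2, iso M (dsum N1 N2) /\ ~ is_zero N1 /\ ~ is_zero N2.
  apply: contrapT => ne; apply: ndec; split=> // N1 N2 e.
  by apply: contrapT => /not_orP[z1 z2]; apply: ne; exists N1, N2.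
have [||N [K [indN e1]]] := IH N1.
- apply: leq_trans lem; rewrite (rep_size_dsum e) -addn1 leq_add2l.
  exact: rep_size_gt0.
- exact: nz1.
have [f [g fg]] := e; have [f1 [g1 fg1]] := e1.
exists N; have [|K' e'] := @retract_summand M N
    (hcomp (hinl N K) (hcomp g1 (hcomp (hinl N1 N2) g)))
    (hcomp f (hcomp (hfst N1 N2) (hcomp f1 (hfst N K)))); last by exists K'.
move=> a; rewrite [hcomp _ _ a]/= [hcomp f _ a]/= -!mulmxA (mulmxA (g a)) (fg a).2 mul1mx.
rewrite (mulmxA (row_mx 1%:M 0 : 'M_(_, N1 a + N2 a))) (hinl_fst N1 N2 a) mul1mx.
by rewrite (mulmxA (g1 a)) (fg1 a).2 mul1mx; exact: (hinl_fst N K a).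
Qed.

Lemma decomposition_exists M : exists s : seq (rep k C),
  (forall i, (i < size s)%N -> indecomposable (nth zero_rep s i)) /\ iso M (dsums s).
Proof.
have [m] := ubnP (rep_size M); elim: m M => // m IH M; rewrite ltnS => lem.
have [M0|/indecomposable_summand[N [K [indN e]]]] := pselect (is_zero M).
  by exists [::]; split=> //; apply: zero_iso.
have [|s [inds eK]] := IH K.
  apply: leq_trans lem; rewrite (rep_size_dsum e) -add1n leq_add2r.
  exact: rep_size_gt0 indN.1.
exists (N :: s); split=> [[|i] lti|]; [exact: indN | exact: inds |].
exact: iso_trans e (dsum_iso N eK).
Qed.

(** Such an r counts the summands isomorphic to N in any decomposition, so the count is the same for
    all of them and the Krull-Schmidt theorem is not invoked. *)
Lemma multiplicity_additive N (r : rep k C -> nat) :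
  (forall M L, iso M L -> r M = r L) ->
  (forall M L, r (dsum M L) = (r M + r L)%N) -> r zero_rep = 0%N -> r N = 1%N ->
  (forall M, indecomposable M -> r M != 0%N -> iso M N) ->
  forall M, multiplicity N M = r M.
Proof.
move=> r_iso rD r0 rN rind.
have rdsums s : (forall i, (i < size s)%N -> indecomposable (nth zero_rep s i)) ->
    r (dsums s) = count (fun X => `[< iso X N >]) s.
  elim: s => [//|X s IH] ind; rewrite /= rD IH; last by move=> i; apply: (ind i.+1).
  congr (_ + _)%N; case: asboolP => [XN|nXN]; first by rewrite (r_iso _ _ XN).
  by apply: contrapT => /eqP rX; apply: nXN; apply: rind rX; exact: (ind 0%N).
move=> M; apply: xget_unique => [|m [s [ind e ->]]].
  have [s [ind e]] := decomposition_exists M; exists s; split=> //.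
  by rewrite (r_iso _ _ e) rdsums.
by rewrite (r_iso _ _ e) rdsums.
Qed.

End Decomposition.

(** * Zigzag modules and the map from limit to colimit *)

Section Zigzag.
Variables (k : fieldType).
Local Notation B := (path_cat zquiver).
Implicit Types (M N L : rep k B).

Definition zmap N (a b : zvertex) (e : zarrow a b) : 'M[k]_(N a, N b) :=
  @rmap _ B N a b (@QCons zquiver a b b e (@QNil zquiver b)).

Lemma zmap_nat M N (f : hom M N) a b (e : zarrow a b) :
  zmap M e *m f b = f a *m zmap N e.
Proof. exact: hmap_nat. Qed.

Lemma zhom_exists M N (f : forall v : zvertex, 'M[k]_(M v, N v)) :
  (forall a b (e : zarrow a b), zmap M e *m f b = f a *m zmap N e) ->
  exists g : hom M N, forall v, g v = f v.
Proof.
move=> fe; have nat (a b : B) (p : arr a b) : rmap M p *m f b = f a *m rmap N p.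
  elim: p => [v|u v w e p IH].
    by rewrite (@rmap1 _ B M v) (@rmap1 _ B N v) mulmx1 mul1mx.
  rewrite (@rmapM _ B M u v w (@QCons zquiver u v v e (@QNil zquiver v)) p).
  rewrite (@rmapM _ B N u v w (@QCons zquiver u v v e (@QNil zquiver v)) p).
  by rewrite -mulmxA IH !mulmxA -fe.
by exists (@Hom k B M N f nat).
Qed.

(** Vertices 2 and 4 are the sources of the quiver, and an element of the limit is determined by its
    values there. *)
Definition zpair N : vectType k := ('rV[k]_(N v2) * 'rV[k]_(N v4))%type.

Section Pairs.
Variable N : rep k B.

Definition zdefect (u : zpair N) : 'rV[k]_(N v3) :=
  u.1 *m zmap N alpha2 - u.2 *m zmap N alpha3.
Definition zleft (u : zpair N) : 'rV[k]_(N v1) := u.1 *m zmap N alpha1.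
Definition zright (u : zpair N) : 'rV[k]_(N v5) := u.2 *m zmap N alpha4.

Lemma zdefect_is_linear : linear zdefect.
Proof.
move=> c u v; rewrite /zdefect /= !mulmxDl -!scalemxAl scalerBr opprD.
by rewrite addrACA.
Qed.
Lemma zleft_is_linear : linear zleft.
Proof. by move=> c u v; rewrite /zleft /= mulmxDl -scalemxAl. Qed.
Lemma zright_is_linear : linear zright.
Proof. by move=> c u v; rewrite /zright /= mulmxDl -scalemxAl. Qed.

HB.instance Definition _ :=
  GRing.isLinear.Build k (zpair N) _ _ zdefect zdefect_is_linear.
HB.instance Definition _ :=
  GRing.isLinear.Build k (zpair N) _ _ zleft zleft_is_linear.
HB.instance Definition _ :=
  GRing.isLinear.Build k (zpair N) _ _ zright zright_is_linear.

(** The limit is [zlim false false]; the flags [l] and [r] additionally demand that the value at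
    vertex 1, respectively 5, is zero. *)
Definition zlim (l r : bool) : {vspace zpair N} :=
  (lker (linfun zdefect) :&: (if l then lker (linfun zleft) else fullv)
   :&: (if r then lker (linfun zright) else fullv))%VS.

Lemma zlimP l r (u : zpair N) : u \in zlim l r <->
  [/\ u.1 *m zmap N alpha2 = u.2 *m zmap N alpha3,
      l -> u.1 *m zmap N alpha1 = 0 & r -> u.2 *m zmap N alpha4 = 0].
Proof.
have lE : u \in (if l then lker (linfun zleft) else fullv)%VS =
          (l ==> (u.1 *m zmap N alpha1 == 0)).
  by case: (l); rewrite ?memvf // memv_ker lfunE.
have rE : u \in (if r then lker (linfun zright) else fullv)%VS =
          (r ==> (u.2 *m zmap N alpha4 == 0)).
  by case: (r); rewrite ?memvf // memv_ker lfunE.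
rewrite !memv_cap lE rE memv_ker lfunE /= subr_eq0.
split=> [/andP[/andP[/eqP-> /implyP zl] /implyP zr]|[-> zl zr]].
  by split=> // [/zl|/zr] /eqP.
by rewrite eqxx /=; apply/andP; split; apply/implyP => h; apply/eqP; [exact: zl | exact: zr].
Qed.

(* The rank of the canonical map from the limit to the colimit of N. *)
Definition zrank : nat :=
  (\dim (zlim false false) - \dim (zlim true false + zlim false true))%N.

Lemma zlim_sub : (zlim true false + zlim false true <= zlim false false)%VS.
Proof.
by rewrite subv_add; apply/andP; split; apply/subvP => u /zlimP[u3 _ _]; apply/zlimP.
Qed.

Lemma zlim_cap : (zlim true false :&: zlim false true)%VS = zlim true true.
Proof.
apply/vspaceP => u; rewrite memv_cap; apply/andP/idP.
  by move=> [/zlimP[u3 u1 _] /zlimP[_ _ u5]]; apply/zlimP.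
by move=> /zlimP[u3 u1 u5]; split; apply/zlimP.
Qed.

Lemma zrankE : (zrank + \dim (zlim true false) + \dim (zlim false true)
  = \dim (zlim false false) + \dim (zlim true true))%N.
Proof.
rewrite -zlim_cap -addnA -dimv_sum_cap addnA; congr (_ + _)%N.
by rewrite /zrank subnK // dimvS // zlim_sub.
Qed.

Lemma zrank_eq0 : (zrank == 0%N) = (zlim false false <= zlim true false + zlim false true)%VS.
Proof.
by rewrite subn_eq0 (geq_leqif (dimv_leqif_sup zlim_sub)).
Qed.

End Pairs.

Definition zpush M N (f : hom M N) (u : zpair M) : zpair N := (u.1 *m f v2, u.2 *m f v4).

Lemma zpush_is_linear M N (f : hom M N) : linear (zpush f).
Proof. by move=> c u v; rewrite /zpush /= !mulmxDl -!scalemxAl. Qed.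

HB.instance Definition _ M N (f : hom M N) :=
  GRing.isLinear.Build k (zpair M) (zpair N) _ (zpush f) (zpush_is_linear f).

Lemma zpush_lim M N (f : hom M N) l r u : u \in zlim M l r -> zpush f u \in zlim N l r.
Proof.
move=> /zlimP[u3 u1 u5]; apply/zlimP; rewrite /= -!mulmxA -!zmap_nat !mulmxA u3.
by split=> // [/u1|/u5] ->; rewrite mul0mx.
Qed.

Lemma dim_zlim_split L M N (g : hom L M) (f : hom M N) (s : hom N M) l r :
  is_kernel g f -> (forall a, s a *m f a = 1%:M) ->
  \dim (zlim M l r) = (\dim (zlim L l r) + \dim (zlim N l r))%N.
Proof.
move=> ker sf; rewrite -(limg_ker_dim (linfun (zpush f)) (zlim M l r)); congr (_ + _)%N.
  have <- : (linfun (zpush g) @: zlim L l r)%VS =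
            (zlim M l r :&: lker (linfun (zpush f)))%VS.
    apply/vspaceP => w; rewrite memv_cap memv_ker lfunE /=.
    apply/memv_imgP/andP => [[v vD ->] | [wD /eqP fw]].
      rewrite lfunE zpush_lim //; split=> //.
      by rewrite /zpush /= -!mulmxA (kernel_comp (v2 : B) ker) (kernel_comp (v4 : B) ker) !mulmx0.
    have [w2 w4] : w.1 *m f v2 = 0 /\ w.2 *m f v4 = 0 by case: fw.
    have [x xE] := kernel_factor ker w2; have [y yE] := kernel_factor ker w4.
    exists ((x, y) : zpair L); last by rewrite lfunE /= /zpush -xE -yE; case: (w).
    have /zlimP := wD; rewrite xE yE -!mulmxA -!zmap_nat !mulmxA => -[e3 e1 e5].
    apply/zlimP; split=> /= [|h|h]; apply: (mono_inj ker.1); rewrite ?mul0mx //.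
      exact: e1.
    exact: e5.
  apply: limg_dim_eq; apply/eqP; rewrite -subv0; apply/subvP => v.
  rewrite memv_cap memv_ker lfunE memv0 => /andP[_ /eqP[gv2 gv4]].
  apply/eqP; case: v gv2 gv4 => x y /= gx gy.
  by congr pair; apply: (mono_inj ker.1); rewrite mul0mx.
congr (\dim _); apply/vspaceP => w; apply/memv_imgP/idP => [[v vD ->] | wD].
  by rewrite lfunE zpush_lim.
exists (zpush s w); first exact: zpush_lim.
by rewrite lfunE /= /zpush /= -!mulmxA !sf !mulmx1; case: (w).
Qed.

Lemma zrank_split L M N (g : hom L M) (f : hom M N) (s : hom N M) :
  is_kernel g f -> (forall a, s a *m f a = 1%:M) -> zrank M = (zrank L + zrank N)%N.
Proof.
move=> ker sf; have := zrankE M; have := zrankE L; have := zrankE N.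
by rewrite !(dim_zlim_split _ _ ker sf); lia.
Qed.

Lemma zrank_zero : zrank (zero_rep : rep k B) = 0%N.
Proof.
apply/eqP; rewrite zrank_eq0; apply/subvP => -[x y] _.
by rewrite (_ : (x, y) = 0) ?mem0v // [x]thinmx0 [y]thinmx0.
Qed.

Lemma zrank_iso M N : iso M N -> zrank M = zrank N.
Proof.
by case/iso_ses => g [f [s [[ker _] sf]]]; rewrite (zrank_split ker sf) zrank_zero.
Qed.

Lemma zrank_dsum M N : zrank (dsum M N) = (zrank M + zrank N)%N.
Proof. by apply: (zrank_split (dsum_ses M N).1) => a; apply: hinr_snd. Qed.

Lemma column_factor m n (A : 'M[k]_(m, n)) (phi : 'cV[k]_m) :
  kermx A *m phi = 0 -> exists psi, phi = A *m psi.
Proof.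
move=> A0; exists (pinvmx A *m phi); apply/eqP; rewrite -subr_eq0 mulmxA.
rewrite -[X in X - _]mul1mx -mulmxBl.
have /submxP[D ->] : (1%:M - A *m pinvmx A <= kermx A)%MS.
  by apply/sub_kermxP; rewrite mulmxBl mul1mx mulmxKpV ?submx_refl // subrr.
by rewrite -mulmxA A0 mulmx0.
Qed.

(* [s] is an element of the limit with nonzero image in the colimit, and    *)
(* [phi] a functional on the colimit that detects it.                       *)
Lemma zrank_section N : zrank N != 0%N ->
  exists (s : forall v : zvertex, 'rV[k]_(N v)) (phi : forall v : zvertex, 'cV[k]_(N v)),
    [/\ forall a b (e : zarrow a b), s a *m zmap N e = s b,
        forall a b (e : zarrow a b), zmap N e *m phi b = phi a
      & forall v, s v *m phi v = 1%:M].
Proof.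
rewrite zrank_eq0 => /subvPn[[a b] /zlimP[/= ab _ _] nab].
pose n := a *m zmap N alpha2.
(* A functional on the space at vertex 3 extends to the colimit exactly when it kills [W]. *)
pose W := (kermx (zmap N alpha1) *m zmap N alpha2 + kermx (zmap N alpha4) *m zmap N alpha3)%MS.
(* If n were in [W], the pair (a, b) would be the sum of a compatible pair vanishing at vertex 1 and
   one vanishing at vertex 5. *)
have nW : ~~ (n <= W)%MS.
  apply: contra nab => /sub_addsmxP[[x y] /= nE].
  pose a' := x *m kermx (zmap N alpha1); pose b' := y *m kermx (zmap N alpha4).
  have a'0 : a' *m zmap N alpha1 = 0 by rewrite -mulmxA mulmx_ker mulmx0.
  have b'0 : b' *m zmap N alpha4 = 0 by rewrite -mulmxA mulmx_ker mulmx0.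
  have nE' : n = a' *m zmap N alpha2 + b' *m zmap N alpha3 by rewrite nE; congr (_ + _); exact: mulmxA.
  have -> : (a, b) = ((a', b - b') : zpair N) + ((a - a', b') : zpair N).
    by congr pair; rewrite /= ?subrK // addrC subrK.
  apply: memv_add; apply/zlimP; split=> //=.
    by rewrite mulmxBl -ab -/n nE' addrK.
  by rewrite mulmxBl -/n nE' [X in X - _]addrC addrK.
have [j nj] : exists j, (n *m cokermx W) ord0 j != 0.
  apply/existsP; rewrite -negb_forall; apply: contra nW => /forallP n0.
  by rewrite submxE; apply/eqP/rowP => j; rewrite [RHS]mxE; exact/eqP/n0.
pose c := (n *m cokermx W) ord0 j.
(* A column of the cokernel projection of [W], scaled to take the value 1 at n. *)
pose phi3 := c^-1 *: (cokermx W *m delta_mx j (ord0 : 'I_1)).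
have nphi : n *m phi3 = 1%:M.
  rewrite -scalemxAr mulmxA -colE [col _ _]mx11_scalar scale_scalar_mx.
  by rewrite [col _ _ _ _]mxE mulVf.
have Wphi : W *m phi3 = 0.
  by rewrite -scalemxAr mulmxA mulmx_coker mul0mx scaler0.
have Wsub m (X : 'M_(m, N v3)) : (X <= W)%MS -> X *m phi3 = 0.
  by case/submxP => D ->; rewrite -mulmxA Wphi mulmx0.
have [phi1 phi1E] : exists psi, zmap N alpha2 *m phi3 = zmap N alpha1 *m psi.
  by apply: column_factor; rewrite mulmxA Wsub // addsmxSl.
have [phi5 phi5E] : exists psi, zmap N alpha3 *m phi3 = zmap N alpha4 *m psi.
  by apply: column_factor; rewrite mulmxA Wsub // addsmxSr.
exists (fun v => match v return 'rV[k]_(N v) with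
   | v1 => a *m zmap N alpha1 | v2 => a | v3 => n | v4 => b | v5 => b *m zmap N alpha4 end).
exists (fun v => match v return 'cV[k]_(N v) with
   | v1 => phi1 | v2 => zmap N alpha2 *m phi3 | v3 => phi3
   | v4 => zmap N alpha3 *m phi3 | v5 => phi5 end).
split=> [x y []|x y []|[]] //=.
- by rewrite -mulmxA -phi1E mulmxA.
- by rewrite mulmxA.
- by rewrite mulmxA -ab.
- by rewrite -mulmxA -phi5E mulmxA -ab.
Qed.

End Zigzag.

(** * The commutative ladder *)

Section Ladder.
Variables (k : fieldType) (n : nat).
Local Notation A := (poset_cat (ladder n)).
Implicit Types (M N L : rep k A) (I J : pinterval (ladder n)).
Local Notation V := (interval_rep k).

Lemma ladder_tops I : exists t, tops I t.
Proof.
have [ok E] := shape_ofP I; move: (shape_of I) ok E => s.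
case: s => [i j a l /and3P[ai il lj]|i j ij|a l al] E.
(* If j = l then x_j lies below y_j, which is the only maximal element; otherwise x_j and y_l are
   both maximal. *)
- have [jl|lj'] := leqP j l.
    have {}lj : l = j by apply/val_inj/anti_leq; rewrite lj jl.
    subst l; exists (ly j, ly j); split=> /=; rewrite ?E ?ly_shape_set ?(leq_trans ai il) ?leqnn //.
    + move=> [[] c]; rewrite ?E ?lx_shape_set ?ly_shape_set ?le_ly ?le_lylx //.
      by move=> /andP[_ cj] jc; congr ly; apply/val_inj/anti_leq; rewrite cj.
    + move=> [[] c]; rewrite ?E ?lx_shape_set ?ly_shape_set ?le_ly ?le_lylx //.
      by move=> /andP[_ cj] jc; congr ly; apply/val_inj/anti_leq; rewrite cj.
    + by move=> [[] c]; rewrite ?E ?lx_shape_set ?ly_shape_set ?le_ly ?le_lxly => /andP[_ ->].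
  exists (lx j, ly l); split=> /=.
  + by rewrite E lx_shape_set leqnn (leq_trans il).
  + by rewrite E ly_shape_set leqnn (leq_trans ai).
  + move=> [[] c]; rewrite ?E ?lx_shape_set ?ly_shape_set ?le_lx ?le_lxly => /andP[_ cj] jc.
      by have := leq_ltn_trans (leq_trans jc cj) lj'; rewrite ltnn.
    by congr lx; apply/val_inj/anti_leq; rewrite cj.
  + move=> [[] c]; rewrite ?E ?lx_shape_set ?ly_shape_set ?le_ly ?le_lylx // => /andP[_ cj] jc.
    by congr ly; apply/val_inj/anti_leq; rewrite cj.
  + by move=> [[] c]; rewrite ?E ?lx_shape_set ?ly_shape_set ?le_ly ?le_lx => /andP[_ ->] //; rewrite orbT.
- have {}ij : (i <= j)%N := ij; exists (lx j, lx j); split=> /=; rewrite ?E ?lx_shape_set ?ij ?leqnn //.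
  + move=> [[] c]; rewrite ?E ?lx_shape_set ?ly_shape_set ?le_lx // => /andP[_ cj] jc.
    by congr lx; apply/val_inj/anti_leq; rewrite cj.
  + move=> [[] c]; rewrite ?E ?lx_shape_set ?ly_shape_set ?le_lx // => /andP[_ cj] jc.
    by congr lx; apply/val_inj/anti_leq; rewrite cj.
  + by move=> [[] c]; rewrite ?E ?lx_shape_set ?ly_shape_set ?le_lx // => /andP[_ ->].
- have {}al : (a <= l)%N := al; exists (ly l, ly l); split=> /=; rewrite ?E ?ly_shape_set ?al ?leqnn //.
  + move=> [[] c]; rewrite ?E ?lx_shape_set ?ly_shape_set ?le_ly // => /andP[_ cj] jc.
    by congr ly; apply/val_inj/anti_leq; rewrite cj.
  + move=> [[] c]; rewrite ?E ?lx_shape_set ?ly_shape_set ?le_ly // => /andP[_ cj] jc.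
    by congr ly; apply/val_inj/anti_leq; rewrite cj.
  + by move=> [[] c]; rewrite ?E ?lx_shape_set ?ly_shape_set ?le_ly // => /andP[_ ->].
Qed.

Lemma xi_mem I v : xi I v \in (I : {set ladder n}).
Proof.
rewrite /xi; have [ok ->] := shape_ofP I; case: (shape_of I) ok => [i j a l|i j|a l] /=.
  by move=> /and3P[ai il lj]; case: v => /=; rewrite ?inE ?mem_x_range ?mem_y_range /=
    ?leqnn ?ai ?il ?(leq_trans ai il) ?(leq_trans il lj) ?orbT.
all: by move=> ij; case: v; rewrite ?mem_x_range ?mem_y_range /= leqnn ij.
Qed.

(** The values of [xi I] include the end points of every row of I, and J is convex. *)
Lemma xi_subset I J : (forall v, xi I v \in (J : {set ladder n})) <-> (I : {set ladder n}) \subset J.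
Proof.
split=> [IJ|/fintype.subsetP IJ v]; last by apply: IJ; exact: xi_mem.
have [ok E] := shape_ofP I; move: IJ; rewrite /xi E.
case: (shape_of I) ok {E} => [i j a l|i j|a l] /= ok IJ;
  have [X1 X2 X4 X5] := And4 (IJ v1) (IJ v2) (IJ v4) (IJ v5);
  apply/fintype.subsetP => -[[] c];
  rewrite ?finset.in_setU ?mem_x_range ?mem_y_range /= ?orbF // => /andP[ic cj].
- exact: interval_convex X2 X1 _ _.
- exact: interval_convex X4 X5 _ _.
- exact: interval_convex X4 X5 _ _.
- exact: interval_convex X2 X1 _ _.
Qed.

(** In the mixed case y_i is the join of y_k and x_i. This lets agreement at vertex 3 stand for
    agreement at every common upper bound. *)
Lemma xi_join I (p : ladder n) :
  (xi I v2 <= p)%O -> (xi I v4 <= p)%O -> (xi I v3 <= p)%O.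
Proof.
rewrite /xi; case: (shape_of I) => //= i j a l.
by case: p => [[] c]; rewrite ?le_ly ?le_lylx ?le_lxly.
Qed.

Lemma rmap_irr M (p q : ladder n) (h h' : (p <= q)%O) :
  @rmap _ A M p q h = @rmap _ A M p q h'.
Proof. by rewrite (bool_irrelevance h h'). Qed.

Lemma zmap_R_xi I M a b (e : zarrow a b) :
  zmap (R_xi I M) e = @rmap _ A M (xi I a) (xi I b) (xi_le I e).
Proof. exact: rmap_irr. Qed.

Lemma row_dim0 J (p : ladder n) (u : 'rV[k]_(interval_dim J p)) :
  p \notin (J : {set ladder n}) -> u = 0.
Proof. by move=> pJ; rewrite -[u]mulmx1 (interval_dim0 1%:M 0 pJ) mulmx0. Qed.

Lemma zmap_interval I J a b (e : zarrow a b) :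
  zmap (R_xi I (V J)) e = const_mx 1 :> 'M[k]_(interval_dim J (xi I a), interval_dim J (xi I b)).
Proof. by []. Qed.

(** All structure maps of the restricted module are injective, so a compatible pair that vanishes at
    an end is zero, while the limit is a line. *)
Lemma zrank_interval1 I J : (forall v, xi I v \in (J : {set ladder n})) ->
  zrank (R_xi I (V J)) = 1%N.
Proof.
move=> xJ; set N := R_xi I (V J).
have inj a b (e : zarrow a b) (u : 'rV_(N a)) : u *m zmap N e = 0 -> u = 0.
  move=> /(congr1 (fun w => w *m ones_col k J (xi I b) *m ones_row k J (xi I a))).
  by rewrite -(mulmxA u) zmap_interval ones_col_map // -mulmxA ones_colK mulmx1 !mul0mx.
have ff l r u : l || r -> u \in zlim N l r -> u = 0.
  move=> lr /zlimP[e3 e1 e5]; suff [u1 u2] : u.1 = 0 /\ u.2 = 0.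
    by case: u u1 u2 {e3 e1 e5} => x y /= -> ->.
  case/orP: lr => [/e1/inj u0|/e5/inj u0]; split=> //.
    by apply: (inj _ _ alpha3); rewrite -e3 u0 mul0mx.
  by apply: (inj _ _ alpha2); rewrite e3 u0 mul0mx.
have z0 l r : l || r -> zlim N l r = 0%VS.
  move=> lr; apply/eqP; rewrite -subv0; apply/subvP => u /(ff _ _ _ lr) ->.
  exact: mem0v.
rewrite /zrank (z0 true false) ?(z0 false true) // addv0 dimv0 subn0.
pose u1 : zpair N := (ones_row k J (xi I v2), ones_row k J (xi I v4)).
have -> : zlim N false false = <[u1]>%VS.
  apply/vspaceP => u; apply/idP/vlineP => [/zlimP[e3 _ _]|[c ->]]; last first.
    apply/zlimP; split=> //=; rewrite -!scalemxAl; congr (c *: _).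
    by rewrite !(ones_row_map k) // ?xJ.
  pose c := (u.1 *m ones_col k J (xi I v2)) ord0 ord0; exists c.
  have uE v (w : 'rV_(N v)) (cw := w *m ones_col k J (xi I v)) :
      w = cw ord0 ord0 *: ones_row k J (xi I v).
    by rewrite -mul_scalar_mx -mx11_scalar -mulmxA ones_colK mulmx1.
  rewrite [LHS]surjective_pairing; congr pair; rewrite [LHS]uE //; congr (_ *: _).
  rewrite /c; move: e3 => /(congr1 (fun w => w *m ones_col k J (xi I v3))).
  by rewrite -!mulmxA !zmap_interval !ones_col_map // => ->.
rewrite dim_vline; suff -> : u1 != 0 by []; apply/eqP => -[/eqP + _].
by rewrite (negPf (ones_row_neq0 k (xJ v2))).
Qed.

Lemma zrank_interval0 I J v : xi I v \notin (J : {set ladder n}) ->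
  zrank (R_xi I (V J)) = 0%N.
Proof.
set N := R_xi I (V J) => vJ; apply/eqP; rewrite zrank_eq0; apply/subvP => u /zlimP[e3 _ _].
have w0 (w : 'rV[k]_(N v)) : w = 0 by exact: (@row_dim0 J (xi I v) w vJ).
have left : u.1 *m zmap N alpha1 = 0 -> u \in (zlim N true false + zlim N false true)%VS.
  by move=> e1; apply: (subvP (addvSl _ _)); apply/zlimP.
have right : u.2 *m zmap N alpha4 = 0 -> u \in (zlim N true false + zlim N false true)%VS.
  by move=> e5; apply: (subvP (addvSr _ _)); apply/zlimP.
case: v vJ w0 => vJ w0.
- by apply: left; rewrite [LHS]w0.
- by apply: left; rewrite [u.1]w0 mul0mx.
(* With a zero space at vertex 3 the two entries of a pair are independent of each other. *)
- have -> : u = ((0, u.2) : zpair N) + ((u.1, 0) : zpair N).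
    by case: (u) => x y; congr pair; rewrite /= ?add0r ?addr0.
  by apply: memv_add; apply/zlimP; split=> //=; rewrite ?mul0mx // [RHS]w0 [LHS]w0.
- by apply: right; rewrite [u.2]w0 mul0mx.
- by apply: right; rewrite [LHS]w0.
Qed.

Lemma zrank_interval I J : zrank (R_xi I (V J)) = ((I : {set ladder n}) \subset J).
Proof.
have [IJ|nIJ] := boolP ((I : {set ladder n}) \subset J).
  exact/zrank_interval1/xi_subset.
have [v vJ] : exists v, xi I v \notin (J : {set ladder n}).
  by apply: contrapT => ne; move/negP: nIJ; apply; apply/xi_subset => v;
     apply: contrapT => /negP vJ; apply: ne; exists v.
exact: zrank_interval0 vJ.
Qed.

(** The section and the functional of [zrank_section] make the all-ones module a retract of N, so
    its complement in N is zero. *)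
Lemma zrank_summand I (N : rep k (path_cat zquiver)) :
  indecomposable N -> zrank N != 0%N -> iso N (R_xi I (V I)).
Proof.
move=> [nz ind] /zrank_section[s [phi [sE phiE sphi]]].
set N1 := R_xi I (V I).
have [g gE] : exists g : hom N1 N, forall v, g v = ones_col k I (xi I v) *m s v.
  apply: zhom_exists => a b e; rewrite zmap_interval mulmxA ones_col_map ?xi_mem //.
  by rewrite -mulmxA sE.
have [f fE] : exists f : hom N N1, forall v, f v = phi v *m ones_row k I (xi I v).
  apply: zhom_exists => a b e; rewrite zmap_interval mulmxA phiE -mulmxA.
  by rewrite ones_row_map ?xi_mem.
have gf v : g v *m f v = 1%:M.
  by rewrite gE fE mulmxA -(mulmxA (ones_col _ _ _)) sphi mulmx1 ones_colK.
have [K e] := retract_summand gf.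
case: (ind _ _ e) => [/(_ v1)|K0].
  by rewrite /= /interval_dim xi_mem.
apply: iso_trans e _; apply: iso_trans (dsum_zero_iso _).
exact/dsum_iso/zero_iso.
Qed.

Definition zvertex_of (i : 'I_5) : zvertex := nth v1 [:: v1; v2; v3; v4; v5] i.

Lemma zvertex_of_surj v : exists i, zvertex_of i = v.
Proof.
by case: v; [exists (inord 0) | exists (inord 1) | exists (inord 2) | exists (inord 3)
  | exists (inord 4)]; rewrite /zvertex_of inordK.
Qed.

Lemma c_xi_zrank M I : c_xi M I = zrank (R_xi I M).
Proof.
apply: (@multiplicity_additive _ (path_cat zquiver) _ _ zvertex_of_surj).
- exact: zrank_iso.
- exact: zrank_dsum.
- exact: zrank_zero.
- by rewrite zrank_interval subxx.
- exact: zrank_summand.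
Qed.

Lemma c_xi_interval I J : c_xi (V J) I = ((I : {set ladder n}) \subset J).
Proof. by rewrite c_xi_zrank zrank_interval. Qed.

(** The upset generated by the images of the sources 2 and 4, with the upset of vertex 1 or 5
    removed according to the flags, matching the vanishing conditions of [zlim]. *)
Definition xi_upset I (l r : bool) : {set ladder n} :=
  [set p | ((xi I v2 <= p)%O || (xi I v4 <= p)%O) &&
           ~~ (l && (xi I v1 <= p)%O || r && (xi I v5 <= p)%O)].

Lemma convex_xi_upset I l r : convex_set (xi_upset I l r).
Proof.
have -> : xi_upset I l r = [set p | (xi I v2 <= p)%O || (xi I v4 <= p)%O] :\:
    [set p | l && (xi I v1 <= p)%O || r && (xi I v5 <= p)%O].
  by apply/finset.setP => p; rewrite !inE andbC.
apply: upset_diff_convex => p q; rewrite !inE => /orP[] + pq.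
- by move=> /le_trans->.
- by move=> /le_trans->; rewrite ?orbT.
- by case/andP => -> /le_trans->.
- by case/andP => -> /le_trans->; rewrite ?orbT.
Qed.

(** Evaluation at the two generating points is bijective: it determines a section, and a pair that
    agrees at vertex 3 extends along the structure maps. *)
Lemma dim_zlim_sections I M l r :
  \dim (zlim (R_xi I M) l r) = \dim (sections M (xi_upset I l r)).
Proof.
set D := xi_upset I l r; set N := R_xi I M.
(* Compatibility persists outside [D] within the generated upset: the removed part is itself an
   upset, and w vanishes on it. *)
have up w p q (pq : (p <= q)%O) : w \in sections M D ->
    (xi I v2 <= p)%O || (xi I v4 <= p)%O -> ev p w *m @rmap _ A M p q pq = ev q w.
  move=> /sectionsP[w0 wc] pU; have [pD|pD] := boolP (p \in D); first exact: wc.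
  rewrite w0 // mul0mx w0 //; move: pD; rewrite !inE pU /= negbK negb_and negbK.
  by case/orP => /andP[-> /le_trans->] //; rewrite ?orbT.
have evalE w p (h : (xi I v2 <= p)%O) : w \in sections M D ->
    ev p w = ev (xi I v2) w *m @rmap _ A M _ _ h by move=> wD; rewrite up ?lexx.
have evalE' w p (h : (xi I v4 <= p)%O) : w \in sections M D ->
    ev p w = ev (xi I v4) w *m @rmap _ A M _ _ h by move=> wD; rewrite up ?lexx ?orbT.
pose ev24 (w : total M) : zpair N := (ev (xi I v2) w, ev (xi I v4) w).
have ev24_lin : linear ev24 by move=> c u v; rewrite /ev24 !linearP.
pose F : {linear total M -> zpair N} := HB.pack ev24 (GRing.isLinear.Build _ _ _ _ _ ev24_lin).
have <- : (linfun F @: sections M D)%VS = zlim N l r.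
  apply/vspaceP => u; apply/memv_imgP/idP => [[w wD ->]|/zlimP[e3 e1 e5]].
    have /sectionsP[w0 _] := wD; apply/zlimP; rewrite lfunE; split=> [|h|h].
    - change (ev (xi I v2) w *m zmap N alpha2 = ev (xi I v4) w *m zmap N alpha3).
      by rewrite !zmap_R_xi -evalE // -evalE'.
    - change (ev (xi I v2) w *m zmap N alpha1 = 0).
      by rewrite zmap_R_xi -evalE // w0 // !inE h lexx /= andbF.
    - change (ev (xi I v4) w *m zmap N alpha4 = 0).
      by rewrite zmap_R_xi -evalE' // w0 // !inE h lexx /= orbT andbF.
  pose w : total M := of_ev (fun p =>
    if pselect (xi I v2 <= p)%O is left h then u.1 *m @rmap _ A M _ p h
    else if pselect (xi I v4 <= p)%O is left h then u.2 *m @rmap _ A M _ p h else 0).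
  have w2 p (h : (xi I v2 <= p)%O) : ev p w = u.1 *m @rmap _ A M _ p h.
    by rewrite ev_of; case: pselect => // h'; rewrite (rmap_irr M h h').
  have trans M1 a b c (ab : (a <= b)%O) (bc : (b <= c)%O) (ac : (a <= c)%O) :
      @rmap _ A M1 a b ab *m @rmap _ A M1 b c bc = @rmap _ A M1 a c ac.
    by rewrite -(@rmapM _ A M1 a b c ab bc); exact: rmap_irr.
  have w4 p (h : (xi I v4 <= p)%O) : ev p w = u.2 *m @rmap _ A M _ p h.
    rewrite ev_of; case: pselect => [h2|_].
      (* Where both generating points lie below p, so does the image of vertex 3, and the two
         extensions agree. *)
      have h3 := xi_join h2 h; move: e3; rewrite !zmap_R_xi.
      move=> /(congr1 (fun x => x *m @rmap _ A M _ p h3)).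
      by rewrite -!mulmxA (trans _ _ _ _ _ _ h2) (trans _ _ _ _ _ _ h).
    by case: pselect => // h'; rewrite (rmap_irr M h h').
  have w0 p : ~~ ((xi I v2 <= p)%O || (xi I v4 <= p)%O) -> ev p w = 0.
    by rewrite negb_or => /andP[/negP n2 /negP n4]; rewrite ev_of; do 2!case: pselect => //.
  exists w.
    apply/sectionsP; split=> [p|p q pq]; rewrite inE.
      rewrite negb_and negbK => /orP[/w0 //|/orP[]/andP[h hp]].
        rewrite (w2 p (le_trans (xi_le I alpha1) hp)) -(trans _ _ _ _ (xi_le I alpha1) hp).
        by rewrite mulmxA -zmap_R_xi e1 ?mul0mx.
      rewrite (w4 p (le_trans (xi_le I alpha4) hp)) -(trans _ _ _ _ (xi_le I alpha4) hp).
      by rewrite mulmxA -zmap_R_xi e5 ?mul0mx.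
    case/andP => /orP[] h _.
      by rewrite (w2 p h) (w2 q (le_trans h pq)) -mulmxA (trans _ _ _ _ _ _ (le_trans h pq)).
    by rewrite (w4 p h) (w4 q (le_trans h pq)) -mulmxA (trans _ _ _ _ _ _ (le_trans h pq)).
  rewrite lfunE /= /ev24 (w2 _ (lexx _)) (w4 _ (lexx _)).
  by rewrite !(@rmap1 _ A M) !mulmx1; case: (u).
apply: limg_dim_eq; apply/eqP; rewrite -subv0; apply/subvP => w.
rewrite memv_cap memv_ker lfunE memv0 => /andP[wD /eqP[w2 w4]].
apply/eqP/ev_inj => p; rewrite linear0.
have [h2|n2] := boolP (xi I v2 <= p)%O; first by rewrite (evalE _ _ h2) // w2 mul0mx.
have [h4|n4] := boolP (xi I v4 <= p)%O; first by rewrite (evalE' _ _ h4) // w4 mul0mx.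
by have /sectionsP[w0 _] := wD; apply: w0; rewrite !inE (negPf n2) (negPf n4).
Qed.

Lemma c_xi_sections M I :
  (c_xi M I + \dim (sections M (xi_upset I true false))
            + \dim (sections M (xi_upset I false true))
   = \dim (sections M (xi_upset I false false)) + \dim (sections M (xi_upset I true true)))%N.
Proof. by rewrite c_xi_zrank -!dim_zlim_sections zrankE. Qed.

(** The four sets [xi_upset] are convex but need not be connected, so each dimension is first
    expanded over interval components. *)
Lemma c_xi_hom_dim I : exists a : {ffun pinterval (ladder n) -> int}, forall M,
  (c_xi M I)%:Z = \sum_J a J * (hom_dim (V J) M)%:Z.
Proof.
have dimE l r : exists a : {ffun pinterval (ladder n) -> nat}, forall M,
    (\dim (sections M (xi_upset I l r)))%:Z = \sum_J (a J)%:Z * (hom_dim (V J) M)%:Z.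
  have [a aE] := dim_sections_components k (convex_xi_upset I l r).
  exists a => M; rewrite aE (big_morph Posz PoszD (erefl _)); apply: eq_bigr => J _.
  by rewrite PoszM hom_dim_sections.
have [a00 E00] := dimE false false; have [a10 E10] := dimE true false.
have [a01 E01] := dimE false true; have [a11 E11] := dimE true true.
exists [ffun J => (a00 J)%:Z + (a11 J)%:Z - (a10 J)%:Z - (a01 J)%:Z] => M.
under eq_bigr do rewrite ffunE !mulrBl mulrDl.
rewrite !sumrB big_split /= -E00 -E11 -E10 -E01.
have := c_xi_sections M I; lia.
Qed.

End Ladder.

(** * Moebius inversion *)

(** Toggling a fixed x in X is a sign-reversing involution on the subsets of X. *)
Lemma alternating_subsets (T : finType) (X : {set T}) :
  \sum_(S : {set T} | S \subset X) (-1) ^+ #|S| = (X == finset.set0)%:R :> int.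
Proof.
have [->|/finset.set0Pn[x xX]] := eqVneq X finset.set0.
  by rewrite (big_pred1 finset.set0) ?cards0 // => S; rewrite finset.subset0.
pose t (S : {set T}) : {set T} := if x \in S then S :\ x else x |: S.
have tK : involutive t.
  move=> S; rewrite /t; have [xS|xS] := boolP (x \in S).
    by rewrite finset.setD11 finset.setD1K.
  by rewrite finset.setU11 finset.setU1K.
have tX S : (t S \subset X) = (S \subset X).
  rewrite /t; case: ifPn => xS; last by rewrite finset.subUset finset.sub1set xX.
  by rewrite -{2}(finset.setD1K xS) finset.subUset finset.sub1set xX.
set s := LHS; suff : s = - s by lia.
rewrite {1}/s (reindex_inj (inv_inj tK)) -sumrN; apply: eq_big => S; rewrite tX // => _.
rewrite /t; case: ifPn => xS; last by rewrite cardsU1 xS exprS mulN1r.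
by rewrite (cardsD1 x S) xS exprS mulN1r opprK.
Qed.

(** * Joins of covers in the poset of intervals *)

Section Joins.
Context {d : Order.disp_t} (P : finPOrderType d).
Implicit Types (I J K L : pinterval P) (S : {set pinterval P}).

Lemma Cov_sub J K : K \in Cov J -> (J : {set P}) \subset K.
Proof. by rewrite inE => /andP[/proper_sub]. Qed.

(** The join is the convex hull of the union of S. It is connected because each of its points is
    joined to a point [j0] of J, which every member of S contains. *)
Lemma join_exists J S : S != finset.set0 -> S \subset Cov J -> exists K, is_join S K.
Proof.
move=> /finset.set0Pn[L0 L0S] /fintype.subsetP SJ.
have [j0 j0J] := interval_neq0 J.
have inS L p : L \in S -> p \in (J : {set P}) -> p \in (L : {set P}).
  by move=> LS pJ; apply: (fintype.subsetP (Cov_sub (SJ _ LS))).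
pose U p := [exists L in S, p \in (L : {set P})].
have UP L p : L \in S -> p \in (L : {set P}) -> U p.
  by move=> LS pL; apply/exists_inP; exists L.
pose H := [set y | [exists x, exists z, [&& U x, U z & (x <= y <= z)%O]]].
have HP y : reflect (exists x z, [/\ U x, U z, (x <= y)%O & (y <= z)%O]) (y \in H).
  rewrite finset.in_set; apply: (iffP existsP) => [[x /existsP[z]]|[x [z [Ux Uz xy yz]]]].
    by move=> /and4P[Ux Uz xy yz]; exists x, z.
  by exists x; apply/existsP; exists z; rewrite Ux Uz xy.
have UH p : U p -> p \in H by move=> Up; apply/HP; exists p, p.
have cH : convex_set H.
  apply/convex_setP => x y z /HP[x1 [_ [Ux1 _ x1x _]]] /HP[_ [z2 [_ Uz2 _ zz2]]] xy yz.
  by apply/HP; exists x1, z2; split=> //; [exact: le_trans x1x xy | exact: le_trans yz zz2].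
have toj0 y : y \in H -> connect (hasse_edge_in H) y j0.
  move=> yH; have /HP[x [_ [Ux _ xy _]]] := yH; have /exists_inP[L LS xL] := Ux.
  apply: (@connect_trans _ _ x).
    by rewrite hasse_connect_sym; apply: convex_connect => //; exact: UH.
  apply: (connect_sub _ (interval_connected xL (inS L j0 LS j0J))) => p q.
  case/and3P => pL qL pq; apply: connect1; rewrite /hasse_edge_in pq andbT.
  by rewrite !UH //; [exact: UP qL | exact: UP pL].
have iH : is_interval H.
  apply/and3P; split=> //; first by apply/finset.set0Pn; exists j0; apply/UH/(UP L0)/inS.
  apply/forall_inP => x xH; apply/forall_inP => y yH.
  by apply: connect_trans (toj0 x xH) _; rewrite hasse_connect_sym; exact: toj0.
exists (PInterval iH); apply/andP; split.
  by apply/forall_inP => L LS; apply/fintype.subsetP => p pL; apply/UH/(UP L).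
apply/forallP => K'; apply/implyP => /forall_inP SK'; apply/fintype.subsetP => y.
have UK' p : U p -> p \in (K' : {set P}).
  by move=> /exists_inP[L LS pL]; exact: (fintype.subsetP (SK' L LS)).
by move=> /HP[x [z [Ux Uz xy yz]]]; apply: (interval_convex (UK' x Ux) (UK' z Uz)).
Qed.

(** The conjunct on J accounts for the empty S, whose join is read as J; for other S it follows from
    the conjunct on S. *)
Lemma join_above_sub J K S : S \subset Cov J ->
  ((join_above J S : {set P}) \subset K) =
  ((J : {set P}) \subset K) && (S \subset [set L : pinterval P | (L : {set P}) \subset K]).
Proof.
move=> SJ; rewrite /join_above; have [->|S0] := eqVneq S finset.set0.
  by rewrite finset.sub0set andbT.
case: pickP => [K0 /andP[/forall_inP up /forallP least] | no]; last first.
  by have [K0] := join_exists S0 SJ; rewrite no.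
have /finset.set0Pn[L0 L0S] := S0.
apply/idP/andP => [K0K | [_ /fintype.subsetP SK]].
  split.
    apply: fintype.subset_trans (Cov_sub (fintype.subsetP SJ _ L0S)) _.
    exact: fintype.subset_trans (up _ L0S) K0K.
  apply/fintype.subsetP => L LS; rewrite inE; exact: fintype.subset_trans (up _ LS) K0K.
apply: (implyP (least K)); apply/forall_inP => L /SK; by rewrite inE.
Qed.

(** If J is strictly below K, an interval of least cardinality among those strictly above J and
    inside K covers J. *)
Lemma Cov_below J K : (J : {set P}) \subset K ->
  (Cov J :&: [set L : pinterval P | (L : {set P}) \subset K] == finset.set0) = (J == K).
Proof.
move=> JK; apply/eqP/eqP => [C0|<-]; last first.
  apply/finset.setP => L; rewrite !inE; apply/negP => /andP[/andP[JL _] LJ].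
  by move: JL; rewrite properE LJ andbF.
apply: contrapT => nJK.
have JpK : (J : {set P}) \proper K.
  by rewrite properEneq JK andbT; apply/eqP => E; apply: nJK; exact/val_inj.
pose Q := [pred L : pinterval P | ((J : {set P}) \proper L) && ((L : {set P}) \subset K)].
have QK : Q K by rewrite /= JpK subxx.
have [L /andP[JL LK] Lmin] := @arg_minnP _ K Q (fun L => #|(L : {set P})|) QK.
have : L \in Cov J :&: [set L : pinterval P | (L : {set P}) \subset K].
  rewrite !inE JL LK andbT /=; apply/forallP => L'; apply/negP => /andP[JL' L'L].
  have := Lmin L'; rewrite /= JL' (fintype.subset_trans (proper_sub L'L) LK) => /(_ isT).
  by rewrite leqNgt proper_card.
by rewrite C0 inE.
Qed.

End Joins.

(** * The interval approximation on interval modules and in terms of dim-hom *)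

Section Delta.
Variables (k : fieldType) (n : nat).
Local Notation V := (interval_rep k).

(** When J lies in K, the surviving terms are the signs of the sets of covers of J inside K; their
    sum is 1 or 0 according to whether there are no such covers, that is, whether J = K. *)
Lemma delta_xi_interval (J K : pinterval (ladder n)) :
  delta_xi (V K) J = (J == K)%:R.
Proof.
rewrite ffunE; under eq_bigr => S SJ do rewrite c_xi_interval (join_above_sub K SJ).
have [JK|nJK] := boolP ((J : {set ladder n}) \subset K); last first.
  rewrite big1 => [|S _]; last by rewrite mulr0.
  by case: eqP nJK => // ->; rewrite subxx.
rewrite -(Cov_below JK) -alternating_subsets big_mkcond [RHS]big_mkcond.
apply: eq_bigr => S _; rewrite finset.subsetI.
by case: (S \subset Cov J) => //=; case: (S \subset _); rewrite ?mulr1 ?mulr0.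
Qed.

Lemma delta_xi_hom_dim : exists b : pinterval (ladder n) -> pinterval (ladder n) -> int,
  forall M J, delta_xi M J = \sum_I b J I * (hom_dim (V I) M)%:Z.
Proof.
pose a I := sval (cid (@c_xi_hom_dim k n I)).
have aE I M : (c_xi M I)%:Z = \sum_J a I J * (hom_dim (V J) M)%:Z.
  exact: (svalP (cid (@c_xi_hom_dim k n I))).
exists (fun J I => \sum_(S : {set pinterval (ladder n)} | S \subset Cov J)
                     (-1) ^+ #|S| * a (join_above J S) I) => M J.
rewrite ffunE; under [RHS]eq_bigr do rewrite mulr_suml.
rewrite exchange_big; apply: eq_bigr => S _.
by rewrite aE mulr_sumr; apply: eq_bigr => I _; rewrite mulrA.
Qed.

End Delta.

(** * Grothendieck groups *)

Section Grothendieck.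
Variables (k : fieldType) (C : category) (E : ses_class k C).
Implicit Types (M N L : rep k C).


Definition K0_pi (x : {freeg iso_class k C}) : K0 E :=
  (\pi_(Quotient.quot (K0_relations E)) x)%qT.

Lemma K0_piB : {morph K0_pi : x y / x - y}.
Proof. by move=> x y; exact: pi_is_zmod_morphism. Qed.

HB.instance Definition _ :=
  GRing.isZmodMorphism.Build {freeg iso_class k C} (K0 E) K0_pi K0_piB.

Lemma K0_pi_eq x y : K0_pi x = K0_pi y <-> K0_relation E (x - y).
Proof.
split=> [/eqP|rxy]; last apply/eqP; rewrite /K0_pi -Quotient.idealrBE; [move/asboolP|].
  by [].
exact/asboolP.
Qed.

Lemma K0_pi_repr (x : K0 E) : K0_pi (repr x) = x.
Proof. exact: reprK. Qed.

Lemma K0_class_ses L M N (g : hom L M) (f : hom M N) :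
  short_exact g f -> E g f -> K0_class E M = K0_class E L + K0_class E N.
Proof.
move=> ses Egf; apply/eqP; rewrite -subr_eq0 opprD addrA; apply/eqP.
have -> : K0_class E M - K0_class E L - K0_class E N =
          K0_pi (free_class M - free_class L - free_class N).
  by rewrite !raddfB.
rewrite -(raddf0 K0_pi); apply/K0_pi_eq; rewrite subr0.
by apply: K0_relation_gen; exists L, M, N, g, f.
Qed.

Lemma free_class_iso M N : iso M N -> free_class M = free_class N.
Proof.
move=> MN; rewrite /free_class; congr << _ >>.
by apply/eqmodP/asboolP.
Qed.

Lemma iso_repr M : iso (repr (\pi_(iso_class k C) (M : {classic rep k C}))%qT) M.
Proof. by have /eqmodP/asboolP := reprK (\pi_(iso_class k C) (M : {classic rep k C}))%qT. Qed.

Lemma K0_ind (Q : K0 E -> Prop) :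
  Q 0 -> (forall x y, Q x -> Q y -> Q (x - y)) -> (forall M, Q (K0_class E M)) ->
  forall x, Q x.
Proof.
move=> Q0 QB QM x; rewrite -[x]K0_pi_repr -[repr x]freeg_sumE raddf_sum.
have QN y : Q y -> Q (- y) by move=> Qy; rewrite -sub0r; exact: QB.
have QD y z : Q y -> Q z -> Q (y + z) by move=> Qy /QN Qz; rewrite -[z]opprK; exact: QB.
have Qn y m : Q y -> Q (y *+ m) by move=> Qy; elim: m => [|m IH]; rewrite ?mulrS //; exact: QD.
apply: (big_ind Q) => // z _.
have -> : << coeff z (repr x) *g z >> = free_class (repr z : rep k C) *~ coeff z (repr x).
  by rewrite /free_class reprK freegU_mulz intz.
rewrite raddfMz; case: (coeff _ _) => m; first exact/Qn/QM.
by rewrite NegzE mulrNz; exact/QN/Qn/QM.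
Qed.

Lemma K0_ext (G : zmodType) (F F' : {additive K0 E -> G}) :
  (forall M, F (K0_class E M) = F' (K0_class E M)) -> forall x, F x = F' x.
Proof.
move=> FF'; apply: K0_ind => [|x y Fx Fy|//]; first by rewrite !raddf0.
by rewrite !raddfB Fx Fy.
Qed.

(** Universal property of K0. Isomorphism invariance makes the value on a class independent of its
    representative, and additivity kills the relators. *)
Lemma K0_lift (G : zmodType) (phi : rep k C -> G) :
  (forall M N, iso M N -> phi M = phi N) ->
  (forall L M N (g : hom L M) (f : hom M N),
     short_exact g f -> E g f -> phi M = phi L + phi N) ->
  exists F : {additive K0 E -> G}, forall M, F (K0_class E M) = phi M.
Proof.
move=> phi_iso phi_ses.
pose psi (x : {freeg iso_class k C}) : G :=
  fglift (fun c : iso_class k C => phi (repr c : rep k C) : zmodule G) x.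
have psiB : {morph psi : x y / x - y} by move=> x y; exact: (lift_is_additive (fun c : iso_class k C => phi (repr c : rep k C) : zmodule G) x y).
have psiM M : psi (free_class M) = phi M.
  by rewrite /psi /free_class liftU scale1r; apply: phi_iso; exact: iso_repr.
have psi0 x : K0_relation E x -> psi x = 0.
  elim=> {x} [|x [L [M [N [g [f [ses Egf ->]]]]]]|x y _ px _ py].
  - by have := psiB 0 0; rewrite !subrr.
  - by rewrite !psiB !psiM (phi_ses _ _ _ g f) // -addrA -opprD subrr.
  - by rewrite psiB px py subrr.
pose F (x : K0 E) := psi (repr x).
have FE x : F (K0_pi x) = psi x.
  by apply/eqP; rewrite -subr_eq0 -psiB psi0 //; apply/K0_pi_eq; rewrite K0_pi_repr.
have FB : {morph F : x y / x - y}.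
  by move=> x y; rewrite -[x]K0_pi_repr -[y]K0_pi_repr -K0_piB !FE psiB.
pose Fa : {additive K0 E -> G} := HB.pack F (GRing.isZmodMorphism.Build _ _ F FB).
by exists Fa => M; rewrite /= [K0_class E M]/(K0_pi _) FE psiM.
Qed.
End Grothendieck.

(** * Invariants of ladder modules *)

Section Invariants.
Variables (k : fieldType) (n : nat).
Local Notation A := (poset_cat (ladder n)).
Local Notation T := (pinterval (ladder n)).
Local Notation V := (@interval_rep _ (ladder n) k).
Implicit Types (M N L : rep k A).

Definition hom_dims M : {ffun T -> int} := [ffun I => (hom_dim (V I) M)%:Z].

Lemma hom_dims_split L M N (g : hom L M) (f : hom M N) :
  short_exact g f -> split_ses g f -> hom_dims M = hom_dims L + hom_dims N.
Proof.
move=> [ker _] [s sf]; apply/ffunP => I; rewrite !ffunE !hom_dim_sections -PoszD.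
by rewrite (dim_sections_ses ker (split_lifts sf)).
Qed.

Lemma hom_dims_approx L M N (g : hom L M) (f : hom M N) :
  short_exact g f -> approx_ses V g f -> hom_dims M = hom_dims L + hom_dims N.
Proof.
move=> [ker _] fa; apply/ffunP => I; rewrite !ffunE !hom_dim_sections -PoszD.
by rewrite (right_approx_dim I ker fa).
Qed.

Lemma hom_dims_iso M N : iso M N -> hom_dims M = hom_dims N.
Proof.
case/iso_ses => g [f [s [ses sf]]].
rewrite (hom_dims_split ses); last by exists s.
suff -> : hom_dims zero_rep = 0 by rewrite add0r.
by apply/ffunP => I; rewrite !ffunE hom_dim_sections dim_sections_zero.
Qed.

Definition delta_coef : T -> T -> int := sval (cid (delta_xi_hom_dim k n)).

Lemma delta_coefE M J : delta_xi M J = \sum_I delta_coef J I * hom_dims M I.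
Proof.
rewrite (svalP (cid (delta_xi_hom_dim k n)) M J); apply: eq_bigr => I _.
by rewrite ffunE.
Qed.

(** Delta is a fixed linear function of [hom_dims], so it inherits additivity on any sequence where
    [hom_dims] is additive. *)
Lemma delta_xi_add L M N : hom_dims M = hom_dims L + hom_dims N ->
  delta_xi M = delta_xi L + delta_xi N.
Proof.
move=> E; apply/ffunP => J; rewrite [RHS]ffunE !delta_coefE -big_split E.
by apply: eq_bigr => I _; rewrite ffunE mulrDr.
Qed.

Lemma delta_xi_iso M N : iso M N -> delta_xi M = delta_xi N.
Proof. by move/hom_dims_iso => E; apply/ffunP => J; rewrite !delta_coefE E. Qed.

Definition ladder_top (I : T) := sval (cid (ladder_tops I)).

Lemma ladder_topP I : tops I (ladder_top I).
Proof. exact: svalP (cid (ladder_tops I)). Qed.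

Local Notation rcls := (K0_class (approx_ses V)).

Definition interval_comb (y : {ffun T -> int}) : K0_rel V := \sum_t rcls (V t) *~ y t.

Lemma interval_combB : {morph interval_comb : x y / x - y}.
Proof.
move=> x y; rewrite /interval_comb -sumrB; apply: eq_bigr => t _.
by rewrite !ffunE mulrzBr.
Qed.

Lemma interval_comb1 t : interval_comb [ffun u => (u == t)%:R] = rcls (V t).
Proof.
rewrite /interval_comb (bigD1 t) //= ffunE eqxx mulr1z big1 ?addr0 // => u /negPf ut.
by rewrite ffunE ut mulr0z.
Qed.

(** Induction along covers: the class of M is the class of its cover, a sum of interval classes,
    minus that of the kernel. *)
Lemma interval_comb_surj (x : K0_rel V) : exists y, x = interval_comb y.
Proof.
have zero : exists y, 0 = interval_comb y.
  by exists 0; rewrite -[in RHS](subrr 0) interval_combB subrr.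
have sub x1 x2 : (exists y, x1 = interval_comb y) -> (exists y, x2 = interval_comb y) ->
    exists y, x1 - x2 = interval_comb y.
  by move=> [y1 ->] [y2 ->]; exists (y1 - y2); rewrite interval_combB.
have add x1 x2 : (exists y, x1 = interval_comb y) -> (exists y, x2 = interval_comb y) ->
    exists y, x1 + x2 = interval_comb y.
  by move=> e1 e2; rewrite -[x2]opprK -[- x2]sub0r; do 2!apply: (sub) => //.
have zero_cls : rcls zero_rep = 0.
  have ap : approx_ses V (hzero zero_rep zero_rep) (hzero zero_rep zero_rep : hom (zero_rep : rep k A) _).
    split=> [|Y _ g]; first exact: (dsums_in_add V [::]).
    by exists g => a; rewrite [LHS]thinmx0 [RHS]thinmx0.
  have /eqP := K0_class_ses (zero_ses k A) ap.
  by rewrite -[X in X == _]addr0 (inj_eq (addrI _)) eq_sym => /eqP.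
move: x; apply: (@K0_ind _ _ _ (fun x => exists y, x = interval_comb y)) => // M; elim/(@interval_induction _ _ k _ ladder_topP): M => [M M0|M K i ses [y yE]].
  have -> : rcls M = rcls zero_rep; last by rewrite zero_cls.
  by rewrite /K0_class (@free_class_iso k A M zero_rep) //; apply: zero_iso.
have := K0_class_ses (E := approx_ses V) ses (cover_approx ladder_topP M) => /eqP.
rewrite addrC -subr_eq => /eqP <-; apply: (sub) => //; last by exists y.
rewrite /cover; elim: (cover_index _ M) => [|t s IH].
  by rewrite zero_cls.
(* This split sequence is an approximation sequence: its middle term is in add V, and its
   epimorphism has a section. *)
rewrite (K0_class_ses (E := approx_ses V) (dsum_ses (V t) (dsums [seq V t | t <- s]))).
  by apply: add => //; exists [ffun u => (u == t)%:R]; rewrite interval_comb1.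
split=> [|Y _ g]; first exact: (dsums_in_add V (t :: s)).
exists (hcomp g (hinr _ _)) => a.
by rewrite [hcomp _ _ a]/= -mulmxA (hinr_snd (V t) _ a) mulmx1.
Qed.

End Invariants.

Theorem corollary5p9 (k : fieldType) (n : nat) (hn : (1 <= n)%N) :
  exists p : {additive K0_split k (poset_cat (ladder n))
                       -> {ffun pinterval (ladder n) -> int}},
    [/\ forall M, p (K0_class (@split_ses k (poset_cat (ladder n))) M)
                  = delta_xi M,
        homological_invariant (interval_rep k) p
      & exists h : {additive K0_split k (poset_cat (ladder n))
                             -> {ffun pinterval (ladder n) -> int}},
          [/\ forall M I,
                h (K0_class (@split_ses k (poset_cat (ladder n))) M) I
                = (hom_dim (interval_rep k I) M)%:Z%R,
              is_invariant h
            & equivalent p h]].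
Proof.
pose T := pinterval (ladder n); pose V := @interval_rep _ (ladder n) k.
(* Delta and dim-hom descend both to the split group, as [p] and [h], and to the relative group, as
   [phi] and [hr]. *)
have [p pE] := K0_lift (@delta_xi_iso k n)
  (fun L M N g f ses sp => delta_xi_add (hom_dims_split ses sp)).
have [h hE] := K0_lift (@hom_dims_iso k n) (@hom_dims_split k n).
have [phi phiE] := K0_lift (@delta_xi_iso k n)
  (fun L M N g f ses ap => delta_xi_add (hom_dims_approx ses ap)).
have [hr hrE] := K0_lift (@hom_dims_iso k n) (@hom_dims_approx k n).
have phi1 t : phi (K0_class (approx_ses V) (V t)) = [ffun u => (u == t)%:R].
  by rewrite phiE; apply/ffunP => J; rewrite delta_xi_interval ffunE.
have phi_comb y : phi (interval_comb k y) = y.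
  rewrite raddf_sum; apply/ffunP => J; rewrite sum_ffunE (bigD1 J) //= big1.
    by rewrite raddfMz phi1 ffunMzE ffunE eqxx addr0 intz.
  by move=> t /negPf tJ; rewrite raddfMz phi1 ffunMzE ffunE eq_sym tJ mul0rz.
have phiK x : interval_comb k (phi x) = x.
  by have [y ->] := interval_comb_surj x; rewrite phi_comb.
have phi_inj : injective phi := can_inj phiK.
(* A split sequence need not give a relator of the relative group; its relation is checked after
   applying the injective [phi], that is, for delta. *)
have [q qE] : exists q : {additive K0_split k (poset_cat (ladder n)) -> K0_rel V},
    forall M, q (K0_class (@split_ses k (poset_cat (ladder n))) M)
              = K0_class (approx_ses V) M.
  apply: K0_lift => [M N MN | L M N g f ses sp]; apply: phi_inj.
    by rewrite !phiE; exact: delta_xi_iso.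
  by rewrite raddfD /= !phiE; exact: (delta_xi_add (hom_dims_split ses sp)).
have pq x : p x = phi (q x).
  by apply: (K0_ext (F' := phi \o q)) => M; rewrite /= qE pE phiE.
have hq x : h x = hr (q x).
  by apply: (K0_ext (F' := hr \o q)) => M; rewrite /= qE hE hrE.
have p_surj : is_invariant p.
  move=> y; exists (\sum_t K0_class (@split_ses k (poset_cat (ladder n))) (V t) *~ y t).
  rewrite pq -[RHS]phi_comb !raddf_sum; apply: eq_bigr => t _ /=.
  by rewrite !raddfMz qE.
have ph x J : p x J = \sum_I delta_coef k J I * h x I.
  move: x J; apply: K0_ind => [J|x y px py J|M J].
  - by rewrite !raddf0 ffunE big1 // => I _; rewrite ffunE mulr0.
  - rewrite !raddfB !ffunE px py -sumrB; apply: eq_bigr => I _.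
    by rewrite !ffunE mulrBr.
  by rewrite pE hE delta_coefE.
have hp x : h x = \sum_t hom_dims (V t) *~ p x t.
  rewrite hq -[q x]phiK -pq raddf_sum; apply: eq_bigr => t _.
  by rewrite raddfMz hrE.
(* That delta of V_J is an indicator function says that [delta_coef] is a one-sided inverse of the
   matrix of [hom_dims]; for square matrices it is two-sided. *)
have BH I J : \sum_t hom_dims (V t) I * delta_coef k t J = (I == J)%:R.
  pose Bm := \matrix_(i, j < #|{: pinterval (ladder n)}|) delta_coef k (enum_val i) (enum_val j).
  pose Hm := \matrix_(i, j < #|{: pinterval (ladder n)}|) hom_dims (V (enum_val j)) (enum_val i).
  have BH1 : Bm *m Hm = 1%:M.
    apply/matrixP => i j; rewrite !mxE.
    transitivity (delta_xi (V (enum_val j)) (enum_val i)).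
      rewrite delta_coefE [RHS](reindex _ (onW_bij _ (@enum_val_bij _))).
      by apply: eq_bigr => l _; rewrite !mxE.
    by rewrite delta_xi_interval (inj_eq enum_val_inj).
  have /matrixP/(_ (enum_rank I) (enum_rank J)) := mulmx1C BH1.
  rewrite !mxE (inj_eq enum_rank_inj) => <-; rewrite (reindex _ (onW_bij _ (@enum_val_bij _))).
  by apply: eq_bigr => i _; rewrite !mxE !enum_rankK.
exists p; split=> //.
  split=> // [|Q pQ _|M|].
  - by split=> [t|t u]; [exact: interval_indecomposable | exact: interval_iso_inj].
  - exact: interval_projective (@ladder_topP n) _ pQ.
  - exact: interval_finite_resolution (@ladder_topP n) M.
  exists q, phi; split=> // [|x]; last by rewrite pq.
  by exists (@interval_comb k n) => x; [exact: phiK | exact: phi_comb].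
exists h; split=> [M I|y|x]; first by rewrite hE ffunE.
  (* To reach y under [h], the matrix [delta_coef] is applied to y and the result lifted along [p];
     [BH] then returns y. *)
  have [x px] := p_surj [ffun t => \sum_J delta_coef k t J * y J].
  exists x; apply/ffunP => I; rewrite hp sum_ffunE px.
  under eq_bigr do rewrite ffunMzE [X in _ *~ X]ffunE -mulrzr intz mulr_sumr.
  rewrite exchange_big (bigD1 I) //= [X in _ + X]big1 => [|J JI].
    under eq_bigr do rewrite mulrA.
    by rewrite -mulr_suml BH eqxx mul1r addr0.
  under eq_bigr do rewrite mulrA.
  by rewrite -mulr_suml BH eq_sym (negPf JI) mul0r.
split=> x0; first by rewrite hp x0 big1 // => t _; rewrite ffunE mulr0z.
by apply/ffunP => J; rewrite ph x0 big1 ?ffunE // => I _; rewrite ffunE mulr0.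
Qed.
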